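(* We have $$\mu\big((x+1)^2(y^2+y+1)-4xy\big)=\frac1\pi\left\{\frac12\,B\!\left(\tfrac14,\tfrac14\right)\,{}_3F_2\!\left(\tfrac14,\tfrac14,1;\tfrac34,\tfrac54;\tfrac14\right)-\frac16\,B\!\left(\tfrac34,\tfrac34\right)\,{}_3F_2\!\left(\tfrac34,\tfrac34,1;\tfrac54,\tfrac74;\tfrac14\right)\right\}.$$
   Context: For a polynomial $P(x,y)$, the (logarithmic) Mahler measure is $\mu(P)=\int_0^1\int_0^1\log\left|P(e^{2\pi i t},e^{2\pi i u})\right|\,dt\,du$. $B(a,b)=\Gamma(a)\Gamma(b)/\Gamma(a+b)$ is the Beta function, and ${}_3F_2(a_1,a_2,a_3;b_1,b_2;z)=\sum_{n\ge0}\frac{(a_1)_n(a_2)_n(a_3)_n}{(b_1)_n(b_2)_n}\frac{z^n}{n!}$ with $(a)_n=a(a+1)\cdots(a+n-1)$. *)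

(* Defs.v *)
From HB Require Import structures.
From mathcomp Require Import all_boot all_order all_algebra.
From mathcomp Require Export complex.
From mathcomp Require Import all_classical all_reals all_analysis.
Set Implicit Arguments.
Unset Strict Implicit.
Unset Printing Implicit Defensive.
Import Order.TTheory GRing.Theory Num.Theory numFieldNormedType.Exports.
Local Open Scope classical_set_scope.
Local Open Scope ring_scope.
Local Open Scope complex_scope.

(* e^(2 pi i t) *)
Definition cexp2pi (R : realType) (t : R) : R[i] :=
  cos (2 * pi * t) +i* sin (2 * pi * t).

(* A polynomial in x, y is a [{poly {poly R[i]}}] with x = 'X and y = 'Y, and
   P.[x, y] is its value. Since lne 0 = -oo, the integrand is log|P| also at
   the zeros of P, and the value may be infinite (-oo for P = 0). *)
Definition mahler_measure (R : realType) (P : {poly {poly R[i]}}) : \bar R :=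
  (\int[@lebesgue_measure R]_(u in `[0%R, 1%R])
     \int[@lebesgue_measure R]_(t in `[0%R, 1%R])
       lne (Normc.normc P.[cexp2pi t, cexp2pi u])%:E)%E.

(* Euler's integral; this is the Gamma function for 0 < s only. *)
Definition Gamma (R : realType) (s : R) : R :=
  (\int[@lebesgue_measure R]_(x in `]0, +oo[) (x `^ (s - 1) * expR (- x)))%R.

Definition Beta (R : realType) (a b : R) : R :=
  Gamma a * Gamma b / Gamma (a + b).

Definition pochhammer (R : realType) (a : R) (n : nat) : R :=
  \prod_(i < n) (a + i%:R).

(* Meaningful only if no lower parameter is in {0, -1, -2, ...} and the
   series converges (in particular if |z| < 1). *)
Definition hyp3F2 (R : realType) (a1 a2 a3 b1 b2 z : R) : R :=
  limn (series (fun n : nat =>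
    pochhammer a1 n * pochhammer a2 n * pochhammer a3 n
      / (pochhammer b1 n * pochhammer b2 n) * (z ^+ n / n`!%:R))).

(* Main.v *)
(** With c = cos (pi t) and s = sin (pi t), the polynomial has modulus
    4 c^2 |tau - 2 cos (2 pi u)| on the torus, where tau = s^2 / c^2.  Jensen's
    formula for K(a) := int_0^1 log |a - 2 cos (2 pi u)| du is obtained from the
    doubling relation 2 K(a) = K(a^2 - 2) and a uniform bound: K = 0 on [-2, 2]
    and K(x + 1/x) = log x for x >= 1.  Since 4 log x is the integral of dw / w
    over x^-2 < w < x^2, i.e. over sqrt w + 1 / sqrt w < x + 1 / x, exchanging the
    integrals over t and w turns the Mahler measure into
      1 / (2 pi) * int_0^oo atan (X(w)) dw / w,
      X(w) = w^(1/4) (1 + w)^(-1/2) <= 2^(-1/2).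
    Expanding atan in powers of X(w) gives the terms
    (-1)^n / (2 n + 1) * Beta ((2 n + 1) / 4, (2 n + 1) / 4), and the even and the
    odd n form the two hypergeometric series. *)

Require Import Defs.
From HB Require Import structures.
From mathcomp Require Import all_boot all_order all_algebra.
From mathcomp Require Import all_classical all_reals all_analysis.
From mathcomp Require Import measurable_realfun ring lra.
Set Implicit Arguments.
Unset Strict Implicit.
Unset Printing Implicit Defensive.
Import Order.TTheory GRing.Theory Num.Theory numFieldNormedType.Exports.
Local Open Scope classical_set_scope.
Local Open Scope ring_scope.

(** * Integrals over the unit interval *)

(** The integrands are logarithms that reach -oo, so Tonelli and linearity do not apply to them
    directly. They are all bounded above, and sums, changes of variable and exchanges of integrals
    are carried out on the non-negative functions [C - h] and transported back. This permits
    integrating over u first, as Jensen's formula requires, although the Mahler measure has t as its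
    inner variable. The factor 4 c^2 of the modulus contributes nothing: it equals |-2 - 2 cos (2 pi
    t)|, whose logarithm integrates to K(-2) = 0. The delicate half of the uniform bound is the
    lower one: |a - 2 cos (2 pi u)| vanishes at most quadratically in u, with constants independent
    of a in [-2, 2]. Beyond 2, a comparison with a = 2 takes its place. Since X(w)^2 <= 1/2, the
    N-th remainder of the arctangent series is at most 2^-N X(w), so termwise integration comes with
    an explicit error. The argument 1/4 of the hypergeometric series is the limit ratio of
    consecutive beta values B(s, s) and B(s + 1, s + 1). *)

Lemma ge0_integral_affine (R : realType) (a b : R) (D : set R)
    (f : R -> \bar R) : 0 < a -> measurable D -> measurable_fun D f ->
  (forall x, D x -> 0 <= f x)%E ->
  (\int[@lebesgue_measure R]_(x in D) f x =
   a%:E * \int[@lebesgue_measure R]_(x in [set x | D (a * x + b)%R])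
            f (a * x + b)%R)%E.
Proof.
move=> a0 mD mf f0.
pose phi : measurableTypeR R -> measurableTypeR R := fun x => a * x + b.
have mphi : measurable_fun setT phi.
  suff : measurable_fun [set: R] (fun x => a * x + b) by [].
  by apply: measurable_funD => //; exact: measurable_funM.
have [nu nuE] : exists nu : {measure set (measurableTypeR R) -> \bar R},
    nu = pushforward (@lebesgue_measure R) phi :> (set _ -> \bar R).
  by unshelve refine (ex_intro _ (pushforward (@lebesgue_measure R) phi :
    {measure set (measurableTypeR R) -> \bar R}) _).
pose a1 : {nonneg R} := NngNum (ltW a0).
pose mu2 := mscale a1 nu.
(* Lebesgue measure is determined by its values on half-open intervals, and there it agrees with the
   pushforward along [phi] scaled by [a]. *)
have H A : measurable A -> lebesgue_measure A = mu2 A.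
  apply: lebesgue_measure_unique => //= _ [[x y]] _ <-.
  rewrite /mu2 /mscale nuE /pushforward/= [phi @^-1` _](_ : _ =
      `](x - b) / a, (y - b) / a]%classic); last first.
    apply/seteqP; split => z /=; rewrite !in_itv/= /phi => /andP[zx zy];
      apply/andP; split.
    - by rewrite ltr_pdivrMr// ltrBlDr mulrC.
    - by rewrite ler_pdivlMr// lerBrDr mulrC.
    - by move: zx; rewrite ltr_pdivrMr// ltrBlDr mulrC.
    - by move: zy; rewrite ler_pdivlMr// lerBrDr mulrC.
  rewrite !lebesgue_measure_itv/= !lte_fin.
  rewrite (ltr_pM2r (_ : 0 < a^-1)) ?invr_gt0// ltrD2r.
  case: ifPn => _; last by rewrite mule0.
  rewrite -!EFinB -EFinM; congr EFin.
  rewrite -mulrBl mulrCA divff ?gt_eqF//; ring.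
transitivity (\int[mu2]_(x in D) f x)%E.
  by apply: eq_measure_integral => A mA _; exact: H.
rewrite ge0_integral_mscale//; congr (_ * _)%E.
by rewrite nuE (ge0_integral_pushforward mphi)// => y /set_mem; exact: f0.
Qed.

Lemma measurable_lne_EFin (R : realType) :
  measurable_fun [set: R] (fun r : R => lne r%:E).
Proof.
apply: measurable_fun_ifT => //=; last by apply/measurable_EFinP.
exact: measurable_fun_ler.
Qed.

(** The value [lne 0 = -oo] is absorbing here, so the product rule survives vanishing factors and
    the zeros of the polynomial need no separate treatment. *)
Lemma lneM_ge0 (R : realType) (x y : R) : 0 <= x -> 0 <= y ->
  (lne (x * y)%:E = lne x%:E + lne y%:E)%E.
Proof.
rewrite !le_eqVlt => /predU1P[<-|x0].
  by rewrite mul0r le0_lneNy ?lexx// addNye.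
case/predU1P => [<-|y0].
  by rewrite mulr0 [lne 0]le0_lneNy ?lexx// addeNy.
by rewrite !lne_EFin ?mulr_gt0// lnM.
Qed.

Lemma lne_le_ln (R : realType) (x C : R) : 0 < C -> x <= C ->
  (lne x%:E <= (ln C)%:E)%E.
Proof.
move=> C0 xC; have [x0|x0] := ltP 0 x; last by rewrite le0_lneNy ?leNye.
by rewrite lne_EFin// lee_fin ler_ln.
Qed.

Lemma sub_EFin_ge0 (R : realType) (C : R) (h : \bar R) :
  (0 <= C%:E - h)%E = (h <= C%:E)%E.
Proof.
by case: h => [r| |] /=; rewrite ?leNye ?leey// -EFinD !lee_fin subr_ge0.
Qed.

Section unit_interval.
Context {R : realType}.
Local Notation mu := (@lebesgue_measure R).
Local Notation I := (`[0%R, 1%R]%classic : set R).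
Implicit Types f g h : R -> \bar R.

Lemma lebesgue_measure_unit_itv : mu I = 1%E.
Proof. by rewrite lebesgue_measure_itv/= lte01 sube0. Qed.

Lemma integral_unit_cst (c : R) : (\int[mu]_(x in I) c%:E = c%:E)%E.
Proof. by rewrite integral_cst//= lebesgue_measure_unit_itv mule1. Qed.

(** For a finite integral of [g] this is linearity. Otherwise both sides are -oo: the positive part
    of [C - g] is at most [|C|], while its negative part is at least [g - |C|] and so has infinite
    integral. *)
Lemma integral_unit_sub (C : R) g : measurable_fun I g ->
  (forall x, 0 <= g x)%E ->
  (\int[mu]_(x in I) (C%:E - g x) = C%:E - \int[mu]_(x in I) g x)%E.
Proof.
move=> mg g0.
have iC (c : R) : mu.-integrable I (fun=> c%:E).
  by apply/integrableP; split => //=; rewrite integral_cst//= lebesgue_measure_unit_itv mule1 ltry.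
have [gfin|goo] := ltP (\int[mu]_(x in I) g x)%E +oo%E.
  have ig : mu.-integrable I g.
    apply/integrableP; split => //.
    by under eq_integral do rewrite gee0_abs//.
  by rewrite integralB//= integral_unit_cst.
have goo' : (\int[mu]_(x in I) g x = +oo)%E by apply/eqP; rewrite -leye_eq.
rewrite goo' /= integralE; set f := (fun x => C%:E - g x)%E.
have mf : measurable_fun I f by apply: emeasurable_funB => //; exact: measurable_cst.
have fp : (\int[mu]_(x in I) f^\+ x <= `|C|%:E)%E.
  rewrite -[leRHS]integral_unit_cst; apply: ge0_le_integral => //=.
  - exact: measurable_funepos.
  - move=> x _; rewrite /f funeposE ge_max; apply/andP; split; last by rewrite lee_fin.
    apply: (@le_trans _ _ C%:E); last by rewrite lee_fin ler_norm.
    by rewrite /f -[leRHS]adde0; apply: leeD2l; rewrite oppe_le0.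
have fn : (\int[mu]_(x in I) f^\- x = +oo)%E.
  apply/eqP; rewrite -leye_eq -goo'.
  have : (\int[mu]_(x in I) g x <= \int[mu]_(x in I) (f^\- x + `|C|%:E))%E.
    apply: ge0_le_integral => //=.
    - by apply: emeasurable_funD => //; exact: measurable_funeneg.
    - move=> x _; rewrite /f funenegE.
      case: (g x) (g0 x) => [r| |] //= r0.
      rewrite -EFin_max -EFinD lee_fin -lerBlDr le_max; apply/orP; left.
      by rewrite opprB lerB// ler_norm.
  rewrite ge0_integralD//=; last exact: measurable_funeneg.
  rewrite integral_unit_cst goo' leye_eq => /eqP.
  by case: (\int[mu]_(x in I) f^\- x)%E.
rewrite fn; case: (\int[mu]_(x in I) f^\+ x)%E fp => //.
Qed.

(** The device that reduces a function bounded above, possibly -oo somewhere or of integral -oo, to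
    a non-negative one. *)
Lemma integral_unit_bdd h (C : R) : measurable_fun I h ->
    (forall x, h x <= C%:E)%E ->
  (\int[mu]_(x in I) h x = C%:E - \int[mu]_(x in I) (C%:E - h x))%E.
Proof.
move=> mh hC; rewrite -integral_unit_sub.
- apply: eq_integral => x _; case: (h x) (hC x) => [r| |] //= _.
  by rewrite -?EFinN -?EFinD; congr EFin; ring.
- by apply: emeasurable_funB => //; exact: measurable_cst.
- by move=> x; rewrite sub_EFin_ge0.
Qed.

(** Upper bounds alone exclude the form oo - oo, so additivity holds even when an integral is -oo;
    it is read off from the non-negative functions [C1 - h1] and [C2 - h2]. *)
Lemma integral_unit_bddD h1 h2 (C1 C2 : R) : measurable_fun I h1 ->
    measurable_fun I h2 ->
    (forall x, h1 x <= C1%:E)%E -> (forall x, h2 x <= C2%:E)%E ->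
  (\int[mu]_(x in I) (h1 x + h2 x)
   = \int[mu]_(x in I) h1 x + \int[mu]_(x in I) h2 x)%E.
Proof.
move=> mh1 mh2 hC1 hC2.
rewrite (@integral_unit_bdd _ (C1 + C2)); last 2 first.
- exact: emeasurable_funD.
- by move=> x; rewrite EFinD leeD.
rewrite (integral_unit_bdd mh1 hC1) (integral_unit_bdd mh2 hC2).
transitivity ((C1 + C2)%:E - \int[mu]_(x in I) ((C1%:E - h1 x) + (C2%:E - h2 x)))%E.
  congr (_ - _)%E; apply: eq_integral => x _.
  case: (h1 x) (hC1 x) => [r1| |]; case: (h2 x) (hC2 x) => [r2| |] //= _ _.
  by rewrite -?EFinN -?EFinD; congr EFin; ring.
have m1 : measurable_fun I (fun x => C1%:E - h1 x)%E.
  by apply: emeasurable_funB => //; exact: measurable_cst.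
have m2 : measurable_fun I (fun x => C2%:E - h2 x)%E.
  by apply: emeasurable_funB => //; exact: measurable_cst.
have g1 x : (0 <= C1%:E - h1 x)%E by rewrite sub_EFin_ge0.
have g2 x : (0 <= C2%:E - h2 x)%E by rewrite sub_EFin_ge0.
rewrite ge0_integralD//.
have := @integral_ge0 _ _ _ mu I _ (fun x _ => g1 x).
have := @integral_ge0 _ _ _ mu I _ (fun x _ => g2 x).
case: (\int[mu]_(x in I) (C1%:E - h1 x))%E => [r1| |];
case: (\int[mu]_(x in I) (C2%:E - h2 x))%E => [r2| |] //= _ _.
by rewrite -?EFinN -?EFinD; congr EFin; ring.
Qed.

End unit_interval.

(** The reflection, which the condition [0 < a] of [ge0_integral_affine] excludes. *)
Lemma ge0_integral_opp (R : realType) (D : set R) (f : R -> \bar R) :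
  measurable D -> measurable_fun D f -> (forall x, D x -> 0 <= f x)%E ->
  (\int[@lebesgue_measure R]_(x in D) f x =
   \int[@lebesgue_measure R]_(x in [set x | D (- x)%R]) f (- x)%R)%E.
Proof.
move=> mD mf f0.
transitivity (\int[pushforward (@lebesgue_measure R)
    (-%R : _ -> measurableTypeR R)]_(x in D) f x)%E.
  by apply: eq_measure_integral => A mA _; exact/esym/lebesgue_measureN.
rewrite (ge0_integral_pushforward (phi := -%R : measurableTypeR R -> measurableTypeR R))//.
by move=> y /set_mem; exact: f0.
Qed.

Lemma ge0_integral_itv_split (R : realType) (a b c : R) (f : R -> \bar R) :
  a <= b -> b <= c -> measurable_fun `[a, c] f ->
  (forall x, (a <= x <= c)%R -> (0 <= f x)%E) ->
  (\int[@lebesgue_measure R]_(x in `[a, c]) f x =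
   \int[@lebesgue_measure R]_(x in `[a, b]) f x +
   \int[@lebesgue_measure R]_(x in `[b, c]) f x)%E.
Proof.
move=> ab bc mf f0.
have E : `[a, c]%classic = `[a, b[%classic `|` `[b, c]%classic :> set R.
  by rewrite -itv_bndbnd_setU// bnd_simp.
rewrite E ge0_integral_setU//=.
- congr (_ + _)%E; apply: integral_itv_bndo_bndc.
  apply: measurable_funS mf => // x /=; rewrite !in_itv/= => /andP[-> /=].
  by move=> /ltW xb; exact: le_trans bc.
- by rewrite -[X in measurable_fun X]E.
- move=> x xab; apply: f0.
  have : (`[a, b[%classic `|` `[b, c]%classic) x by [].
  by rewrite -E /= in_itv.
- rewrite disj_set2E; apply/eqP/seteqP; split => x //=.
  by rewrite !in_itv/= => -[/andP[_ xb] /andP[bx _]]; move: xb; rewrite ltNge bx.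
Qed.

Lemma continuous_powR_gt0 (R : realType) (p x : R) : 0 < x ->
  {for x, continuous (fun z : R => z `^ p)}.
Proof.
move=> x0; apply: differentiable_continuous; apply/derivable1_diffP.
by apply: derivable_powR; rewrite in_itv/= x0.
Qed.

Lemma continuous_mul_powR (R : realType) (s p x : R) : 0 < x ->
  {for x, continuous (fun z : R => s * z `^ p)}.
Proof.
by move=> x0; apply: continuousM; [exact: cst_continuous|exact: continuous_powR_gt0].
Qed.

(** For s < 1 the integrand is unbounded at 0, so the fundamental theorem is applied on the
    intervals [y / (n + 1), y], which exhaust ]0, y], and the limit is monotone. *)
Lemma integral_powR (R : realType) (s y : R) : 0 < s -> 0 < y ->
  (\int[@lebesgue_measure R]_(x in `]0%R, y]) (s * x `^ (s - 1))%:E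
   = (y `^ s)%:E)%E.
Proof.
move=> s0 y0.
pose F n : set R := `[y / n.+1%:R, y]%classic.
have n0 n : 0 < y / n.+1%:R by rewrite divr_gt0.
have FE : `]0, y]%classic = \bigcup_n F n.
  apply/seteqP; split => [x /=|x [n _]]; rewrite /F/= !in_itv/=; last first.
    by move=> /andP[yx ->]; rewrite (lt_le_trans _ yx).
  move=> /andP[x0 xy]; have [n] := ltr_add_invr (y := 0) (x := x / y) (divr_gt0 x0 y0).
  rewrite add0r ltr_pdivlMr// mulrC => /ltW nx.
  by exists n => //; rewrite /F/= in_itv/= nx xy.
have ff x : (0 <= (s * x `^ (s - 1))%:E)%E by rewrite lee_fin mulr_ge0// ?powR_ge0// ltW.
have mf D : measurable D -> measurable_fun D (fun x => (s * x `^ (s - 1))%:E).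
  move=> mD; apply/measurable_EFinP/measurable_funM => //.
  by apply: measurable_funTS; exact: measurable_powR.
have intF n : (\int[@lebesgue_measure R]_(x in F n) (s * x `^ (s - 1))%:E
    = (y `^ s - (y / n.+1%:R) `^ s)%:E)%E.
  have [->|n0'] := eqVneq n 0%N.
    by rewrite /F divr1 set_itv1 integral_set1 subrr.
  have yny : y / n.+1%:R < y by rewrite ltr_pdivrMr// ltr_pMr// ltr1n ltnS lt0n.
  rewrite (@continuous_FTC2 _ _ (fun x => x `^ s))//.
  - apply: continuous_in_subspaceT => x; rewrite inE/= in_itv/= => /andP[yx _].
    have x0 : 0 < x by exact: lt_le_trans yx.
    exact: continuous_mul_powR.
  - split.
    + move=> x; rewrite in_itv/= => /andP[yx _].
      by apply: derivable_powR; rewrite in_itv/= (lt_trans _ yx).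
    + by apply: cvg_at_right_filter; exact: continuous_powR_gt0.
    + by apply: cvg_at_left_filter; exact: continuous_powR_gt0.
  - move=> x; rewrite in_itv/= => /andP[yx _].
    by rewrite powR_derive1// in_itv/= (lt_trans _ yx).
rewrite FE.
have ndF : nondecreasing_seq F.
  apply/nondecreasing_seqP => n; apply/subsetPset => x; rewrite /F/= !in_itv/=.
  move=> /andP[yx ->]; rewrite andbT (le_trans _ yx)// ler_pM2l//.
  by rewrite lef_pV2 ?posrE// ler_nat.
have mF n : measurable (F n) by exact: measurable_itv.
have cv := @ge0_nondecreasing_set_cvg_integral _ (measurableTypeR R) R F
  (fun x => (s * x `^ (s - 1))%:E) (@lebesgue_measure R) ndF mF
  (fun n => mf _ (mF n)) (fun _ x _ => ff x).
rewrite -(cvg_lim (@ereal_hausdorff R) cv).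
under eq_fun do rewrite intF.
apply/cvg_lim => //; apply: cvg_EFin; first by near=> n.
rewrite /comp/= -[X in _ --> X]subr0; apply: cvgB; first exact: cvg_cst.
have /cvg_at_rightP := powR_cvg0 s0; apply; split => //.
rewrite -[X in _ --> X](mulr0 y); apply: cvgM; first exact: cvg_cst.
exact: cvg_harmonic.
Unshelve. all: by end_near. Qed.

Lemma measurable_lne_comp (R : realType) d (T : measurableType d) (D : set T)
    (f : T -> R) : measurable_fun D f ->
  measurable_fun D (fun x => lne (f x)%:E).
Proof. by move=> mf; exact: (measurableT_comp (@measurable_lne_EFin R) mf). Qed.

(** By log z < z at z = x^(-1/2), the integrand is at most 2 x^(-1/2) on ]0, 1], and that bound has
    integral 4. The negative half follows by reflection. *)
Lemma integral_Nlne_lty (R : realType) :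
  (\int[@lebesgue_measure R]_(x in `[(-1)%R, 1%R]) - lne `|x|%:E < +oo)%E.
Proof.
have mN D : measurable D -> measurable_fun D (fun x : R => (- lne `|x|%:E)%E).
  move=> mD; apply: measurable_funTS; apply: measurableT_comp => //.
  by apply: measurable_lne_comp; exact: normr_measurable.
have N0 (x : R) : -1 <= x <= 1 -> (0 <= - lne `|x|%:E)%E.
  move=> x1; rewrite oppe_ge0; have := @lne_le_ln R `|x| 1 ltr01.
  by rewrite ln1; apply; rewrite ler_norml.
have lty : (\int[@lebesgue_measure R]_(x in `[0%R, 1%R]) - lne `|x|%:E < +oo)%E.
  rewrite -integral_itv_obnd_cbnd; last exact: mN.
  apply: (@le_lt_trans _ _ (4 * 1 `^ 2^-1)%:E); last exact: ltry.
  rewrite EFinM -integral_powR// -ge0_integralZl_EFin//; last 2 first.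
  - by move=> x _; rewrite lee_fin mulr_ge0// powR_ge0.
  - apply/measurable_EFinP/measurable_funM => //.
    by apply: measurable_funTS; exact: measurable_powR.
  apply: ge0_le_integral => //.
  - by move=> x /=; rewrite in_itv/= => /andP[x0 x1]; apply: N0; lra.
  - exact: mN.
  - apply/measurable_EFinP/measurable_funM => //; apply/measurable_funM => //.
    by apply: measurable_funTS; exact: measurable_powR.
  - move=> x x01; have /andP[x0 x1] : 0 < x <= 1 by move: x01; rewrite /= in_itv.
    rewrite gtr0_norm// lne_EFin// -EFinN -EFinM lee_fin.
    rewrite mulrA (_ : 4 * 2^-1 = 2); last lra.
    rewrite (_ : 2^-1 - 1 = - 2^-1); last lra.
    have := ln_sublinear (powR_gt0 (- 2^-1) x0); rewrite ln_powR; lra.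
have N1 : -1 <= 0 :> R by lra.
have mNN := mN `[-1, 1]%classic (measurable_itv _).
rewrite (ge0_integral_itv_split N1 ler01 mNN N0) lte_add_pinfty//.
rewrite ge0_integral_opp//; last 2 first.
- exact: mN.
- by move=> x; rewrite /= in_itv/= => /andP[a b]; apply: N0; lra.
rewrite [X in integral _ X](_ : _ = `[0, 1]%classic); last first.
  by apply/seteqP; split => x /=; rewrite !in_itv/= => /andP[a b]; apply/andP; split; lra.
by under eq_integral do rewrite normrN.
Qed.

(** * Integrals of functions of period one *)

Section unit_periodic.
Context {R : realType}.
Local Notation mu := (@lebesgue_measure R).
Local Notation I := (`[0%R, 1%R]%classic : set R).
Implicit Types g h : R -> \bar R.

Lemma integral_unit_le h1 h2 (C : R) : measurable_fun I h1 ->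
    measurable_fun I h2 ->
    (forall x, h1 x <= h2 x)%E -> (forall x, h2 x <= C%:E)%E ->
  (\int[mu]_(x in I) h1 x <= \int[mu]_(x in I) h2 x)%E.
Proof.
move=> m1 m2 h12 hC.
have hC1 x : (h1 x <= C%:E)%E by exact: le_trans (hC x).
rewrite (integral_unit_bdd m1 hC1) (integral_unit_bdd m2 hC).
have mC h : measurable_fun I h -> measurable_fun I (fun x => C%:E - h x)%E.
  by move=> mh; apply: emeasurable_funB => //; exact: measurable_cst.
apply: leeD2l; rewrite leeN2; apply: ge0_le_integral => //.
- by move=> x _; rewrite sub_EFin_ge0.
- exact: mC.
- exact: mC.
- by move=> x _; apply: leeD2l; rewrite leeN2.
Qed.

Lemma measurable_affine_comp g (a b : R) : measurable_fun setT g ->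
  measurable_fun setT (fun x : R => g (a * x + b)).
Proof.
move=> mg; suff mf : measurable_fun [set: R] (fun x : R => a * x + b).
  exact: (measurableT_comp mg mf).
by apply: measurable_funD => //; exact: measurable_funM.
Qed.

(** Doubling stretches each half of the unit interval onto a full period; in [E] the left end [c] of
    the half is 0 or 1/2. *)
Lemma ge0_integral_unit_double g : measurable_fun setT g ->
    (forall x, 0 <= g x)%E -> (forall x, g (x + 1) = g x) ->
  (\int[mu]_(x in I) g (2 * x)%R = \int[mu]_(x in I) g x)%E.
Proof.
move=> mg g0 g1.
have mg2 : measurable_fun setT (fun x : R => g (2 * x)).
  have := measurable_affine_comp 2 0 mg.
  by under eq_fun do rewrite addr0.
have E (c : R) : c = 0 \/ c = 2^-1 ->
    (\int[mu]_(x in `[c, (c + 2^-1)%R]) g (2 * x)%R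
     = (2^-1)%:E * \int[mu]_(x in I) g x)%E.
  move=> cE; rewrite (@ge0_integral_affine _ 2^-1 c)//; last first.
    exact: measurable_funTS.
  congr (_ * _)%E; rewrite [X in integral _ X](_ : _ = I); last first.
    apply/seteqP; split => x /=; rewrite !in_itv/= => /andP[a b].
      by apply/andP; split; lra.
    by apply/andP; split; lra.
  apply: eq_integral => x _; rewrite mulrDr mulrA divff// mul1r.
  by case: cE => ->; rewrite ?mulr0 ?addr0// divff.
have h0 : 0 <= 2^-1 :> R by lra.
have h1 : 2^-1 <= 1 :> R by lra.
have g0' (x : R) : 0 <= x <= 1 -> (0 <= g (2 * x)%R)%E by [].
rewrite (ge0_integral_itv_split h0 h1 (measurable_funTS mg2) g0').
have := E 0; rewrite add0r => -> ; last by left.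
have := E 2^-1; rewrite (_ : 2^-1 + 2^-1 = 1); last lra.
move=> ->; last by right.
rewrite -ge0_muleDl ?lee_fin// -?EFinD.
by rewrite (_ : 2^-1 + 2^-1 = 1) ?mul1e//; lra.
Qed.

(** The shift carries the first half of the period to the second, and the second to the first up to
    a full period. *)
Lemma ge0_integral_unit_half_shift g : measurable_fun setT g ->
    (forall x, 0 <= g x)%E -> (forall x, g (x + 1) = g x) ->
  (\int[mu]_(x in I) g (x + 2^-1)%R = \int[mu]_(x in I) g x)%E.
Proof.
move=> mg g0 g1.
have mg2 : measurable_fun setT (fun x : R => g (x + 2^-1)).
  have := measurable_affine_comp 1 2^-1 mg.
  by under eq_fun do rewrite mul1r.
have J : [set x : R | (`[2^-1, 1]%classic : set R) (1 * x + 2^-1)] = `[0, 2^-1]%classic.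
  apply/seteqP; split => x /=; rewrite !in_itv/= => /andP[a b].
    by apply/andP; split; lra.
  by apply/andP; split; lra.
have h0 : 0 <= 2^-1 :> R by lra.
have h1 : 2^-1 <= 1 :> R by lra.
have g0' (x : R) : 0 <= x <= 1 -> (0 <= g (x + 2^-1)%R)%E by [].
rewrite (ge0_integral_itv_split h0 h1 (measurable_funTS mg2) g0').
have g0'' (x : R) : 0 <= x <= 1 -> (0 <= g x)%E by [].
rewrite (ge0_integral_itv_split h0 h1 (measurable_funTS mg) g0'').
rewrite !(@ge0_integral_affine _ 1 2^-1 `[2^-1, 1]%classic)//; last 2 first.
- exact: measurable_funTS.
- exact: measurable_funTS.
rewrite !mul1e J addeC; congr (_ + _)%E; apply: eq_integral => x _.
  by rewrite mul1r -addrA (_ : 2^-1 + 2^-1 = 1)//; lra.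
by rewrite mul1r.
Qed.

Lemma integral_unit_double h (C : R) : measurable_fun setT h ->
    (forall x, h x <= C%:E)%E -> (forall x, h (x + 1) = h x) ->
  (\int[mu]_(x in I) h (2 * x)%R = \int[mu]_(x in I) h x)%E.
Proof.
move=> mh hC h1.
have mh2 : measurable_fun setT (fun x : R => h (2 * x)).
  have := measurable_affine_comp 2 0 mh.
  by under eq_fun do rewrite addr0.
rewrite (integral_unit_bdd (measurable_funTS mh) hC).
rewrite (@integral_unit_bdd _ (fun x => h (2 * x)) C (measurable_funTS mh2))//.
congr (_ - _)%E; apply: (@ge0_integral_unit_double (fun x => C%:E - h x)%E).
- by apply: emeasurable_funB => //; exact: measurable_cst.
- by move=> x; rewrite sub_EFin_ge0.
- by move=> x; rewrite h1.
Qed.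

Lemma integral_unit_half_shift h (C : R) : measurable_fun setT h ->
    (forall x, h x <= C%:E)%E -> (forall x, h (x + 1) = h x) ->
  (\int[mu]_(x in I) h (x + 2^-1)%R = \int[mu]_(x in I) h x)%E.
Proof.
move=> mh hC h1.
have mh2 : measurable_fun setT (fun x : R => h (x + 2^-1)).
  have := measurable_affine_comp 1 2^-1 mh.
  by under eq_fun do rewrite mul1r.
rewrite (integral_unit_bdd (measurable_funTS mh) hC).
rewrite (@integral_unit_bdd _ (fun x => h (x + 2^-1)) C (measurable_funTS mh2))//.
congr (_ - _)%E; apply: (@ge0_integral_unit_half_shift (fun x => C%:E - h x)%E).
- by apply: emeasurable_funB => //; exact: measurable_cst.
- by move=> x; rewrite sub_EFin_ge0.
- by move=> x; rewrite h1.
Qed.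

End unit_periodic.

(** * Jensen's formula for [a - 2 cos] *)

(** Jordan's inequality, by concavity. The difference [f] of the two sides vanishes at 0 and 1/2;
    were it negative at [x], its derivative would be negative somewhere before [x] and positive
    somewhere after, whereas [df] decreases. *)
Lemma sin_pi_ge (R : realType) (x : R) : 0 <= x <= 2^-1 ->
  2 * x <= sin (pi * x).
Proof.
move=> /andP[x0 x1]; rewrite leNgt; apply/negP => sx.
pose f (z : R) := sin (pi * z) - 2 * z.
pose df (z : R) := pi * cos (pi * z) - 2.
have df_f (z : R) : is_derive z (1 : R) f (df z).
  rewrite /f /df; apply: is_deriveB.
  - have d2 : is_derive z (1 : R) (fun z : R => pi * z) pi.
      by have := is_deriveZ (f := @id R) pi (is_derive_id z 1); rewrite /GRing.scale/= mulr1.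
    rewrite [pi * cos _]mulrC.
    exact: (@is_derive1_comp R sin (fun z => pi * z) z _ pi (is_derive_sin _) d2).
  - by have := is_deriveZ (f := @id R) 2 (is_derive_id z 1); rewrite /GRing.scale/= mulr1.
have cf (D : set R) : {within D, continuous f}.
  apply: continuous_subspaceT => z; apply: differentiable_continuous.
  by apply/derivable1_diffP; exact: ex_derive.
have f0 : f 0 = 0 by rewrite /f !mulr0 sin0 subrr.
have f1 : f 2^-1 = 0 by rewrite /f sin_pihalf divff// subrr.
have fx : f x < 0 by rewrite /f subr_lt0.
have x0' : 0 < x by rewrite lt_neqAle x0 andbT; apply/eqP => xE; move: fx; rewrite -xE f0 ltxx.
have x1' : x < 2^-1 by rewrite lt_neqAle x1 andbT; apply/eqP => xE; move: fx; rewrite xE f1 ltxx.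
have [y /[!in_itv]/= /andP[y0 yx]] := MVT x0' (fun z _ => df_f z) (cf _).
rewrite f0 subr0 subr0 => fxE.
have [z /[!in_itv]/= /andP[xz z1]] := MVT x1' (fun z _ => df_f z) (cf _).
rewrite f1 sub0r => fxE'.
have dy : df y < 0 by rewrite -(pmulr_llt0 _ x0') -fxE.
have dz : 0 < df z.
  have xx : 0 < 2^-1 - x by rewrite subr_gt0.
  by rewrite -(pmulr_lgt0 _ xx) -fxE' oppr_gt0.
have : df z < df y; last by move=> zy; have := lt_trans dz (lt_trans zy dy); rewrite ltxx.
have p0 := pi_gt0 R.
rewrite ltrD2r ltr_pM2l// ltr_cos ?in_itv/=; last 2 first.
- apply/andP; split; nra.
- apply/andP; split; nra.
by rewrite ltr_pM2l// (lt_trans yx).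
Qed.

(** The sine is unchanged when u + b is replaced by 1 - u - b. One of the two lies in [0, 1/2],
    where Jordan's inequality applies, and both are at least |u - b|. *)
Lemma sin_pi_add_ge (R : realType) (u b : R) : 0 <= u <= 2^-1 -> 0 <= b <= 2^-1 ->
  2 * `|u - b| <= `|sin (pi * (u + b))|.
Proof.
move=> /andP[u0 u1] /andP[b0 b1].
have [ub|ub] := leP (u + b) 2^-1.
  apply: le_trans (ler_norm _); apply: le_trans (sin_pi_ge _); last lra.
  by rewrite ler_pM2l// ler_norml; apply/andP; split; lra.
rewrite (_ : pi * (u + b) = pi - pi * (1 - u - b)); last ring.
rewrite sinB sinpi cospi mul0r sub0r mulN1r opprK.
apply: le_trans (ler_norm _); apply: le_trans (sin_pi_ge _); last lra.
by rewrite ler_pM2l// ler_norml; apply/andP; split; lra.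
Qed.

Lemma sin_pi_sub_ge (R : realType) (u b : R) : 0 <= u <= 2^-1 -> 0 <= b <= 2^-1 ->
  2 * `|u - b| <= `|sin (pi * (u - b))|.
Proof.
move=> /andP[u0 u1] /andP[b0 b1].
have [ub|ub] := leP 0 (u - b).
  apply: le_trans (ler_norm _); rewrite ger0_norm//; apply: sin_pi_ge; lra.
rewrite -[X in sin X]opprK sinN normrN -mulrN; apply: le_trans (ler_norm _).
by rewrite ltr0_norm//; apply: sin_pi_ge; lra.
Qed.

(** The difference of cosines factors as 4 sin (pi (u + b)) sin (pi (u - b)), and each sine is at
    least 2 |u - b| in absolute value. The constant is not sharp; what matters is that it does not
    depend on [b]. *)
Lemma dist_cos_ge (R : realType) (u b : R) : 0 <= u <= 2^-1 -> 0 <= b <= 2^-1 ->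
  8 * `|u - b| ^+ 2 <= `|2 * cos (2 * pi * b) - 2 * cos (2 * pi * u)|.
Proof.
move=> u01 b01.
have -> : 2 * cos (2 * pi * b) - 2 * cos (2 * pi * u)
    = 4 * (sin (pi * (u + b)) * sin (pi * (u - b))).
  rewrite (_ : 2 * pi * b = pi * (u + b) - pi * (u - b)); last ring.
  rewrite (_ : 2 * pi * u = pi * (u + b) + pi * (u - b)); last ring.
  by rewrite cosB cosD; ring.
rewrite !normrM ger0_norm//.
have h1 := sin_pi_add_ge u01 b01; have h2 := sin_pi_sub_ge u01 b01.
have := normr_ge0 (u - b).
move: h1 h2; set p := `|u - b|; set q := `|sin _|; set r := `|sin _| => h1 h2 p0.
have := ler_pM (mulr_ge0 (ler0n R 2) p0) (mulr_ge0 (ler0n R 2) p0) h1 h2.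
have := mulr_ge0 p0 p0; rewrite expr2; lra.
Qed.

Lemma le_lne_EFin (R : realType) (x y : R) : 0 <= x -> x <= y ->
  (lne x%:E <= lne y%:E)%E.
Proof.
rewrite le_eqVlt => /predU1P[<- _|x0 xy]; first by rewrite le0_lneNy ?leNye.
have y0 := lt_le_trans x0 xy.
by rewrite !lne_EFin// lee_fin ler_ln.
Qed.

Definition lne_dist_cos (R : realType) (a u : R) : \bar R :=
  lne `|a - 2 * cos (2 * pi * u)|%:E.

(** The function K of the overview: the logarithmic Mahler measure of the Laurent polynomial a - y -
    1/y. *)
Definition cos_jensen (R : realType) (a : R) : \bar R :=
  (\int[@lebesgue_measure R]_(u in `[0%R, 1%R]) lne_dist_cos a u)%E.

Section cos_jensen.
Context {R : realType}.
Local Notation mu := (@lebesgue_measure R).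
Local Notation I := (`[0%R, 1%R]%classic : set R).
Implicit Types a u : R.

Lemma measurable_cos_mul (k : R) : measurable_fun setT (fun u : R => cos (k * u)).
Proof.
have mk : measurable_fun [set: R] (fun u : R => k * u) by exact: mulrl_measurable.
exact: (measurableT_comp (continuous_measurable_fun (@continuous_cos R)) mk).
Qed.

Lemma measurable_lne_dist_cos a : measurable_fun setT (lne_dist_cos a).
Proof.
apply: measurable_lne_comp; apply: measurableT_comp => //.
by apply: measurable_funB => //; apply: measurable_funM => //; exact: measurable_cos_mul.
Qed.

Lemma dist_cos_le a u : `|a - 2 * cos (2 * pi * u)| <= `|a| + 2.
Proof.
rewrite (le_trans (ler_normB _ _))// lerD2l normrM ger0_norm//.
by rewrite -[leRHS]mulr1 ler_pM2l// cos_max.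
Qed.

Lemma lne_dist_cos_le a u : (lne_dist_cos a u <= (ln (`|a| + 2))%:E)%E.
Proof. by apply: lne_le_ln; [rewrite ltr_wpDl|exact: dist_cos_le]. Qed.

Lemma cos_2pi_add1 u : cos (2 * pi * (u + 1)) = cos (2 * pi * u).
Proof. by rewrite mulrDr mulr1 [X in _ + X]mulrC mulr_natr cosD2pi. Qed.

Lemma lne_dist_cos_periodic a u : lne_dist_cos a (u + 1) = lne_dist_cos a u.
Proof. by rewrite /lne_dist_cos cos_2pi_add1. Qed.

(* [(a - 2 cos x) (a + 2 cos x) = (a^2 - 2) - 2 cos (2 x)], and the integral is
   invariant under both [x -> x + pi] and [x -> 2 x]. *)
Lemma cos_jensen_double a :
  (cos_jensen a + cos_jensen a = cos_jensen (a ^+ 2 - 2))%E.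
Proof.
have mh := measurable_lne_dist_cos a.
have mh' : measurable_fun setT (fun u => lne_dist_cos a (u + 2^-1)).
  have := measurable_affine_comp 1 2^-1 mh.
  by under eq_fun do rewrite mul1r.
rewrite /cos_jensen.
rewrite -[X in (_ + X)%E](integral_unit_half_shift mh (lne_dist_cos_le a)
  (lne_dist_cos_periodic a)).
rewrite -(integral_unit_bddD (measurable_funTS mh) (measurable_funTS mh')
  (lne_dist_cos_le a) (fun u => lne_dist_cos_le a (u + 2^-1))).
rewrite -(integral_unit_double (measurable_lne_dist_cos _) (lne_dist_cos_le _)
  (lne_dist_cos_periodic _)).
apply: eq_integral => u _; rewrite /lne_dist_cos -lneM_ge0// -normrM.
congr (lne `|_|%:E).
rewrite (_ : 2 * pi * (u + 2^-1) = 2 * pi * u + pi); last by field.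
rewrite (_ : 2 * pi * (2 * u) = (2 * pi * u) *+ 2); last by rewrite -mulr_natr; ring.
by rewrite cosDpi cos_mulr2n -mulr_natr; ring.
Qed.

(** With [d] the distance to a zero, a quadratic lower bound becomes domination by -2 log d. The
    factor 4 cancels the constant [ln 4] that makes the integrand non-negative when |a| <= 2. *)
Lemma sub_lne_le (d X : R) : 0 <= d -> 4 * d ^+ 2 <= X ->
  ((ln 4)%:E - lne X%:E <= 2%:E * - lne d%:E)%E.
Proof.
rewrite le_eqVlt => /predU1P[<- _|d0 dX].
  by rewrite [X in (_ <= _ * - X)%E]le0_lneNy//= gt0_muley// leey.
have X0 : 0 < X by apply: lt_le_trans dX; rewrite mulr_gt0// exprn_gt0.
rewrite !lne_EFin// -!EFinN -EFinM -EFinD lee_fin.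
have : ln (4 * d ^+ 2) <= ln X by rewrite ler_ln ?posrE ?mulr_gt0 ?exprn_gt0.
by rewrite lnM ?posrE ?exprn_gt0// lnXn// mulr2n; lra.
Qed.

Lemma integral_Nlne_shift_le (p q c : R) : -1 <= p - c -> q - c <= 1 ->
  (\int[mu]_(u in `[p, q]) - lne `|u - c|%:E
    <= \int[mu]_(x in `[(-1)%R, 1%R]) - lne `|x|%:E)%E.
Proof.
move=> pc qc.
have mN D : measurable D -> measurable_fun D (fun x : R => (- lne `|x|%:E)%E).
  move=> mD; apply: measurable_funTS; apply: measurableT_comp => //.
  by apply: measurable_lne_comp; exact: normr_measurable.
have N0 (x : R) : -1 <= x <= 1 -> (0 <= - lne `|x|%:E)%E.
  move=> x1; rewrite oppe_ge0; have := @lne_le_ln R `|x| 1 ltr01.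
  by rewrite ln1; apply; rewrite ler_norml.
have sub : `[p - c, q - c] `<=` (`[-1, 1]%classic : set R).
  by move=> x /=; rewrite !in_itv/= => /andP[a b]; apply/andP; split; lra.
apply: (@le_trans _ _ (\int[mu]_(x in `[(p - c)%R, (q - c)%R]) - lne `|x|%:E)%E); last first.
  by apply: ge0_subset_integral => //; exact: mN.
rewrite [X in (_ <= X)%E](@ge0_integral_affine _ 1 (- c))//; last 2 first.
- exact: mN.
- by move=> x /sub /=; rewrite in_itv/=; exact: N0.
rewrite mul1e le_eqVlt; apply/orP; left; apply/eqP.
rewrite [X in integral _ X](_ : _ = [set x | `[p - c, q - c]%classic (1 * x - c)]).
  by apply: eq_integral => x _; rewrite mul1r.
by apply/seteqP; split => x /=; rewrite !in_itv/= => /andP[a b]; apply/andP; split; lra.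
Qed.

(** Near its zeros the integrand [ln 4 - lne_dist_cos a] is controlled by -2 log of the distance to
    a zero. Each half of the unit interval holds one zero and contributes at most 2 M, where M is
    the integral of -log |x| over [-1, 1]; hence the bound 4 M, uniform in [a]. *)
Lemma cos_jensen_lower : exists B : R, 0 <= B /\
  forall a, `|a| <= 2 -> ((- B)%:E <= cos_jensen a)%E.
Proof.
pose M := (\int[mu]_(x in `[(-1)%R, 1%R]) - lne `|x|%:E)%E.
have M0 : (0 <= M)%E.
  apply: integral_ge0 => x; rewrite /= in_itv/= => x1.
  rewrite oppe_ge0; have := @lne_le_ln R `|x| 1 ltr01.
  by rewrite ln1; apply; rewrite ler_norml.
have Mfin : M = (fine M)%:E by rewrite fineK// ge0_fin_numE// integral_Nlne_lty.
have m0 : 0 <= fine M by exact: fine_ge0.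
exists (4 * fine M); split; first by rewrite mulr_ge0.
move=> a a2.
have mh := measurable_lne_dist_cos a.
have hC u : (lne_dist_cos a u <= (ln 4)%:E)%E.
  apply: le_trans (lne_dist_cos_le a u) _.
  by rewrite lee_fin ler_ln ?posrE ?ltr_wpDl//; lra.
have ln4 : 0 <= ln 4 :> R by rewrite ln_ge0//; lra.
rewrite /cos_jensen (integral_unit_bdd (measurable_funTS mh) hC).
have mg : measurable_fun setT (fun u => (ln 4)%:E - lne_dist_cos a u)%E.
  by apply: emeasurable_funB => //; exact: measurable_cst.
have g0 u : (0 <= (ln 4)%:E - lne_dist_cos a u)%E by rewrite sub_EFin_ge0.
have piece p q c : -1 <= p - c -> q - c <= 1 ->
    (forall u, p <= u <= q -> 4 * `|u - c| ^+ 2 <= `|a - 2 * cos (2 * pi * u)|) ->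
    (\int[mu]_(u in `[p, q]) ((ln 4)%:E - lne_dist_cos a u) <= (2 * fine M)%:E)%E.
  move=> pc qc H.
  have mN D : measurable D -> measurable_fun D (fun x : R => (- lne `|x - c|%:E)%E).
    move=> mD; apply: measurable_funTS; apply: measurableT_comp => //.
    apply: measurable_lne_comp; apply: measurableT_comp => //.
    by apply: measurable_funB.
  have N0 (x : R) : p <= x <= q -> (0 <= - lne `|x - c|%:E)%E.
    move=> /andP[px xq]; rewrite oppe_ge0; have := @lne_le_ln R `|x - c| 1 ltr01.
    by rewrite ln1; apply; rewrite ler_norml; apply/andP; split; lra.
  apply: (@le_trans _ _ (\int[mu]_(u in `[p, q]) (2%:E * - lne `|u - c|%:E))%E).
    apply: ge0_le_integral => //.
    - exact: measurable_funTS.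
    - by apply: emeasurable_funM; [exact: measurable_cst|exact: mN].
    - by move=> u uI; apply: sub_lne_le => //; apply: H; move: uI; rewrite /= in_itv.
  rewrite ge0_integralZl_EFin//; last exact: mN.
  rewrite EFinM -Mfin; apply: lee_wpmul2l; first by rewrite lee_fin.
  exact: integral_Nlne_shift_le.
(* Writing a = 2 cos (2 pi b) with b in [0, 1/2] places the zeros at b and 1 - b; the second half is
   reduced to the first by u -> 1 - u. *)
pose b := acos (a / 2) / (2 * pi).
have p0 := pi_gt0 R.
have a12 : -1 <= a / 2 <= 1.
  by move: a2; rewrite ler_norml => /andP[? ?]; apply/andP; split; lra.
have cb : a = 2 * cos (2 * pi * b).
  rewrite /b [2 * pi * _]mulrC divfK ?gt_eqF ?mulr_gt0//.
  by rewrite acosK ?in_itv// mulrC divfK.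
have b01 : 0 <= b <= 2^-1.
  have pp : 0 <= 2 * pi :> R by rewrite mulr_ge0// ltW.
  rewrite /b divr_ge0 ?acos_ge0//=.
  by rewrite ler_pdivrMr ?mulr_gt0// mulrA mulVf// mul1r acos_lepi.
have [b0 b1] := andP b01.
have h0 : 0 <= 2^-1 :> R by lra.
have h1 : 2^-1 <= 1 :> R by lra.
rewrite (ge0_integral_itv_split h0 h1 (measurable_funTS mg) (fun x _ => g0 x)).
have P1 := @piece 0 2^-1 b.
have P2 := @piece 2^-1 1 (1 - b).
have Q1 : (\int[mu]_(u in `[0%R, 2^-1%R]) ((ln 4)%:E - lne_dist_cos a u) <= (2 * fine M)%:E)%E.
  apply: P1; [lra|lra|] => u u01; have := dist_cos_ge u01 b01.
  by rewrite -cb; have := exprn_ge0 2 (normr_ge0 (u - b)); lra.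
have Q2 : (\int[mu]_(u in `[2^-1%R, 1%R]) ((ln 4)%:E - lne_dist_cos a u) <= (2 * fine M)%:E)%E.
  apply: P2; [lra|lra|] => u /andP[u0 u1].
  have u01 : 0 <= 1 - u <= 2^-1 by apply/andP; split; lra.
  have := dist_cos_ge u01 b01.
  rewrite -cb (_ : 1 - u - b = - (u - (1 - b))); last ring.
  rewrite normrN (_ : 2 * pi * (1 - u) = - (2 * pi * u) + pi *+ 2); last first.
    by rewrite -mulr_natr; ring.
  rewrite cosD2pi cosN.
  by have := exprn_ge0 2 (normr_ge0 (u - (1 - b))); lra.
have := leeD Q1 Q2; rewrite -EFinD => Q.
apply: (@le_trans _ _ ((ln 4)%:E - (2 * fine M + 2 * fine M)%:E)%E).
  by rewrite -EFinN -EFinD lee_fin; lra.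
by apply: leeD2l; rewrite leeN2.
Qed.

Lemma cos_jensen_le a : (cos_jensen a <= (ln (`|a| + 2))%:E)%E.
Proof.
rewrite -[leRHS]integral_unit_cst.
apply: (integral_unit_le (C := ln (`|a| + 2))) => //.
- exact: measurable_funTS (measurable_lne_dist_cos a).
- exact: lne_dist_cos_le.
Qed.

Lemma cos_jensen_fin a B : (- B%:E <= cos_jensen a)%E ->
  cos_jensen a \is a fin_num.
Proof.
move=> aB; rewrite fin_numE; apply/andP; split.
  by apply/eqP => aE; move: aB; rewrite aE leeNy_eq.
by have := cos_jensen_le a; apply: contraTneq => ->; rewrite leye_eq.
Qed.

(** The map a -> a^2 - 2 sends [-2, 2] into itself, so the doubling relation can be iterated without
    leaving the region where K is bounded; only K = 0 is compatible with 2^n |K(a)| <= C for all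
    n. *)
Lemma cos_jensen_eq0 a : `|a| <= 2 -> cos_jensen a = 0%E.
Proof.
move=> a2; have [B [B0 HB]] := cos_jensen_lower.
have fin (b : R) : `|b| <= 2 -> cos_jensen b \is a fin_num.
  by move=> b2; apply: (@cos_jensen_fin _ B); rewrite -EFinN; exact: HB.
pose k (b : R) := fine (cos_jensen b).
have kE (b : R) : `|b| <= 2 -> cos_jensen b = (k b)%:E by move=> b2; rewrite fineK// fin.
have stab (b : R) : `|b| <= 2 -> `|b ^+ 2 - 2| <= 2.
  rewrite !ler_norml => /andP[b1 b2]; apply/andP; split; rewrite expr2; nra.
have kD (b : R) : `|b| <= 2 -> k b *+ 2 = k (b ^+ 2 - 2).
  move=> b2; have := cos_jensen_double b; rewrite (kE _ b2) (kE _ (stab _ b2)).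
  by rewrite -EFinD => -[]; rewrite mulr2n.
pose C := B + ln 4.
have ln4 : 0 <= ln 4 :> R by rewrite ln_ge0//; lra.
have kC (b : R) : `|b| <= 2 -> `|k b| <= C.
  move=> b2; rewrite ler_norml; apply/andP; split.
    by have := HB _ b2; rewrite kE// lee_fin /C; lra.
  have := cos_jensen_le b; rewrite kE// lee_fin => /le_trans; apply.
  apply: (@le_trans _ _ (ln 4)); last by rewrite /C; lra.
  by rewrite ler_ln ?posrE ?ltr_wpDl//; lra.
(* Each doubling step halves the uniform bound [C]. *)
have kn n : forall b : R, `|b| <= 2 -> `|k b| * 2 ^+ n <= C.
  elim: n => [|n IH] b b2; first by rewrite expr0 mulr1; exact: kC.
  have := IH _ (stab _ b2); rewrite -kD// normrMn exprS mulrA.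
  by rewrite mulr_natr.
rewrite kE//; congr EFin; apply/eqP; rewrite -normr_le0 leNgt; apply/negP => k0.
have [n Hn] : exists n : nat, C < `|k a| * n%:R.
  exists (Num.truncn (C / `|k a|)).+1.
  by rewrite mulrC -ltr_pdivrMr// truncnS_gt.
have := kn n _ a2; apply/negP; rewrite -ltNge (lt_le_trans Hn)//.
by rewrite ler_pM2l// -natrX ler_nat ltnW// ltn_expl.
Qed.

(** With c the cosine, x times the difference of the two sides (absolute value dropped on the right)
    is ((1 + c) (x - 1)^2 + (1 - c) (1 + 2 x)) / 2, a sum of non-negative terms. Integrated
    logarithmically, this compares K(x + 1/x) with K(2) = 0. *)
Lemma dist_cos_gt2_ge (x u : R) : 1 <= x ->
  x / 4 * `|2 - 2 * cos (2 * pi * u)| <= `|x + x^-1 - 2 * cos (2 * pi * u)|.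
Proof.
move=> x1; have x0 : 0 < x by lra.
have := cos_le1 (2 * pi * u); have := cos_geN1 (2 * pi * u).
set c := cos _ => c0 c1.
rewrite ger0_norm; last lra.
apply: le_trans (ler_norm _); rewrite -(ler_pM2l x0).
rewrite (_ : x * (x + x^-1 - 2 * c) = x ^+ 2 + 1 - 2 * x * c); last first.
  by rewrite !mulrDr divff ?gt_eqF//; ring.
rewrite -subr_ge0.
rewrite (_ : _ - _ = ((1 + c) * (x - 1) ^+ 2 + (1 - c) * (1 + 2 * x)) / 2); last by field.
by rewrite divr_ge0// addr_ge0// mulr_ge0 ?sqr_ge0//; lra.
Qed.

(** As (x + 1/x)^2 - 2 = x^2 + 1/x^2, the doubling relation replaces x by x^2, which doubles log x
    as well. So the defect K(x + 1/x) - log x doubles at each step; it stays within [ln 4], from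
    above by x + 1/x + 2 <= 4 x and from below by the comparison with K(2), and therefore
    vanishes. *)
Lemma cos_jensen_addV (x : R) : 1 <= x -> cos_jensen (x + x^-1) = (ln x)%:E.
Proof.
move=> x1.
have lnx4 (y : R) : 1 <= y -> ln (y / 4) = ln y - ln 4.
  by move=> y1; rewrite ln_div ?posrE//; lra.
have lower (y : R) : 1 <= y -> ((ln y - ln 4)%:E <= cos_jensen (y + y^-1))%E.
  move=> y1; have y0 : 0 < y by lra.
  have K2 : cos_jensen (2 : R) = 0%E by rewrite cos_jensen_eq0// ger0_norm.
  have m2 := measurable_lne_dist_cos (2 : R).
  have bd u : ((ln y - ln 4)%:E + lne_dist_cos (2 : R) u <= lne_dist_cos (y + y^-1) u)%E.
    have y4 : 0 <= y / 4 by lra.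
    rewrite -lnx4// -lne_EFin ?divr_gt0// -lneM_ge0//.
    by apply: le_lne_EFin; [exact: mulr_ge0|exact: dist_cos_gt2_ge].
  have -> : ((ln y - ln 4)%:E = \int[mu]_(u in I) ((ln y - ln 4)%:E + lne_dist_cos (2 : R) u))%E.
    rewrite (@integral_unit_bddD _ (fun=> (ln y - ln 4)%:E) _ (ln y - ln 4) (ln (`|2| + 2)))//.
    - by rewrite integral_unit_cst -/(cos_jensen 2) K2 adde0.
    - exact: measurable_funTS.
    - by move=> u; exact: lne_dist_cos_le.
  apply: (integral_unit_le _ _ bd (lne_dist_cos_le _)).
  - by apply: emeasurable_funD; [exact: measurable_cst|exact: measurable_funTS].
  - exact: measurable_funTS (measurable_lne_dist_cos _).
have fin (y : R) : 1 <= y -> cos_jensen (y + y^-1) \is a fin_num.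
  move=> y1; apply: (@cos_jensen_fin _ (ln 4 - ln y)); rewrite -EFinN opprB.
  exact: lower.
pose k (y : R) := fine (cos_jensen (y + y^-1)).
have kE (y : R) : 1 <= y -> cos_jensen (y + y^-1) = (k y)%:E by move=> y1; rewrite fineK// fin.
have sq1 (y : R) : 1 <= y -> 1 <= y ^+ 2 by move=> y1; rewrite exprn_ege1.
have kD (y : R) : 1 <= y -> k y *+ 2 = k (y ^+ 2).
  move=> y1; have := cos_jensen_double (y + y^-1).
  rewrite (_ : (y + y^-1) ^+ 2 - 2 = y ^+ 2 + (y ^+ 2)^-1); last first.
    by field; rewrite gt_eqF//; lra.
  by rewrite !kE ?sq1// -EFinD => -[]; rewrite mulr2n.
have kC (y : R) : 1 <= y -> `|k y - ln y| <= ln 4.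
  move=> y1; have y0 : 0 < y by lra.
  rewrite ler_norml; apply/andP; split.
    by have := lower _ y1; rewrite kE// lee_fin; lra.
  have := cos_jensen_le (y + y^-1); rewrite kE// lee_fin => kl.
  rewrite lerBlDl -lnM ?posrE// (le_trans kl)// ler_ln ?posrE ?mulr_gt0 ?ltr_wpDl//.
  have yV : y^-1 <= 1 by rewrite invf_le1.
  have yV0 : 0 < y^-1 by rewrite invr_gt0.
  by rewrite gtr0_norm; lra.
have kn n : forall y : R, 1 <= y -> `|k y - ln y| * 2 ^+ n <= ln 4.
  elim: n => [|n IH] y y1; first by rewrite expr0 mulr1; exact: kC.
  have := IH _ (sq1 _ y1); rewrite -kD// lnXn; last by lra.
  by rewrite -mulrnBl normrMn exprS mulrA mulr_natr.
rewrite kE//; congr EFin; apply/eqP; rewrite -subr_eq0 -normr_le0 leNgt.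
apply/negP => k0.
have [n Hn] : exists n : nat, ln 4 < `|k x - ln x| * n%:R.
  exists (Num.truncn (ln 4 / `|k x - ln x|)).+1.
  by rewrite mulrC -ltr_pdivrMr// truncnS_gt.
have := kn n _ x1; apply/negP; rewrite -ltNge (lt_le_trans Hn)//.
by rewrite ler_pM2l// -natrX ler_nat ltnW// ltn_expl.
Qed.

End cos_jensen.

(** * Jensen's formula as an integral of dw / w *)

Lemma continuous_invr_gt0 (R : realType) (x : R) : 0 < x ->
  {for x, continuous (fun z : R => z^-1)}.
Proof. by move=> x0; apply: inv_continuous; rewrite gt_eqF. Qed.

Lemma integral_invr (R : realType) (a b : R) : 0 < a -> a < b ->
  (\int[@lebesgue_measure R]_(x in `[a, b]) (x^-1)%:E = (ln b - ln a)%:E)%E.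
Proof.
move=> a0 ab; rewrite (@continuous_FTC2 _ _ (@ln R))//.
- apply: continuous_in_subspaceT => x; rewrite inE/= in_itv/= => /andP[ax _].
  by apply: continuous_invr_gt0; exact: lt_le_trans ax.
- split.
  + move=> x; rewrite in_itv/= => /andP[ax _].
    by apply: ex_derive; apply: is_derive1_ln; exact: lt_trans ax.
  + by apply: cvg_at_right_filter; exact: continuous_ln.
  + by apply: cvg_at_left_filter; apply: continuous_ln; exact: lt_trans ab.
- move=> x; rewrite in_itv/= => /andP[ax _].
  by rewrite derive1E; apply: derive_val; apply: is_derive1_ln; exact: lt_trans ax.
Qed.

Lemma measurable_invr (R : realType) : measurable_fun [set: R] (fun x : R => x^-1).
Proof.
rewrite (_ : (fun x => x^-1) = fun x => if x == 0 then 0 else x^-1); last first.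
  by apply/funext => x; case: eqP => // ->; rewrite invr0.
apply: measurable_fun_if => //.
- by apply: measurable_fun_eqr.
- apply: open_continuous_measurable_fun.
    rewrite setTI [X in open X](_ : _ = ~` [set 0]).
      by apply: closed_openC; exact: closed_eq.
    by apply/seteqP; split => x /=; [move=> /negbT/eqP|move=> /eqP/negbTE].
  by move=> x /set_mem[_ /= /negbT x0]; exact: inv_continuous.
Qed.

(** The condition is sqrt w + 1 / sqrt w < a cleared of its denominator. For a <= 2 it never holds,
    by (sqrt w - 1)^2 >= 0. For a > 2 it says (sqrt w - x) (sqrt w - 1/x) < 0, where x is the larger
    root of x + 1/x = a. *)
Lemma cos_jensen_integral (R : realType) (a : R) : 0 <= a ->
  (cos_jensen a = (4^-1)%:E * \int[@lebesgue_measure R]_(w in `]0%R, +oo[)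
    (if 1 + w < a * Num.sqrt w then w^-1 else 0)%R%:E)%E.
Proof.
move=> a0; have [a2|a2] := leP a 2.
  rewrite cos_jensen_eq0 ?ger0_norm// integral0_eq ?mule0// => w.
  rewrite /= in_itv/= andbT => w0; case: ifPn => // wa; exfalso.
  have s0 := sqrtr_ge0 w; have := sqr_sqrtr (ltW w0).
  move: wa s0; set s := Num.sqrt w => wa s0 sw; rewrite -sw in wa.
  have := sqr_ge0 (s - 1); nra.
pose d := Num.sqrt (a ^+ 2 - 4).
have a4 : 0 <= a ^+ 2 - 4 by nra.
have dd : d ^+ 2 = a ^+ 2 - 4 by rewrite sqr_sqrtr.
have d0 : 0 <= d by exact: sqrtr_ge0.
pose x := (a + d) / 2.
have x1 : 1 < x by rewrite /x; lra.
have x0 : 0 < x by lra.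
have xV : x^-1 = (a - d) / 2.
  apply: (@mulfI _ x); first by rewrite gt_eqF.
  by rewrite divff ?gt_eqF// /x; nra.
have xa : a = x + x^-1 by rewrite xV /x; field.
have V0 : 0 < x^-1 by rewrite invr_gt0.
have V1 : x^-1 < 1 by rewrite invf_lt1.
rewrite [X in cos_jensen X]xa cos_jensen_addV; last exact: ltW.
have AB : (x^-1) ^+ 2 < x ^+ 2 by nra.
have A0 : 0 < (x^-1) ^+ 2 by rewrite exprn_gt0.
transitivity ((4^-1)%:E * \int[@lebesgue_measure R]_(w in `](x^-1 ^+ 2)%R, (x ^+ 2)%R[) (w^-1)%:E)%E.
  rewrite -[X in (_ = _ * X)%E](@integral_itv_bndoo _ _ _ _ true false); last first.
    by apply: measurable_funTS; apply/measurable_EFinP; exact: measurable_invr.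
  rewrite integral_invr// -EFinM exprVn lnV ?posrE ?exprn_gt0// lnXn//.
  by congr EFin; rewrite mulr2n; field.
congr (_ * _)%E.
rewrite integral_mkcond [RHS]integral_mkcond; apply: eq_integral => w _.
rewrite !patchE.
have E : (w \in (`](x^-1 ^+ 2)%R, (x ^+ 2)%R[%classic : set R)) =
    (w \in (`]0%R, +oo[%classic : set R)) && (1 + w < a * Num.sqrt w).
  apply/idP/andP; rewrite !inE/= !in_itv/= ?andbT.
    move=> /andP[Aw wB]; have w0 := lt_trans A0 Aw; split => //.
    have s0 := sqrtr_ge0 w; have sw := sqr_sqrtr (ltW w0).
    move: s0 sw; set s := Num.sqrt w => s0 sw; rewrite -sw in Aw wB *.
    have h1 : x^-1 < s by rewrite -(ltr_pXn2r (n := 2)) ?nnegrE// ltW.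
    have h2 : s < x by rewrite -(ltr_pXn2r (n := 2)) ?nnegrE// ltW.
    have xx : x * x^-1 = 1 by rewrite divff// gt_eqF.
    by rewrite xa; nra.
  move=> [w0 wa].
  have s0 := sqrtr_ge0 w; have sw := sqr_sqrtr (ltW w0).
  move: s0 sw wa; set s := Num.sqrt w => s0 sw wa; rewrite -sw in wa *.
  have xx : x * x^-1 = 1 by rewrite divff// gt_eqF.
  rewrite xa in wa; have sx : (s - x) * (s - x^-1) < 0 by nra.
  rewrite !ltr_pXn2r ?nnegrE// ?(ltW x0)// ?(ltW V0)//.
  apply/andP; split; rewrite ltNge; apply/negP => h; nra.
by rewrite E; case: (w \in _) => //=; case: ifP.
Qed.

(** * The Mahler measure as an arctangent integral *)

(** Tonelli on the whole plane, applied to the extension of [g] by zero outside the rectangle. *)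
Lemma integral_swap (R : realType) (D1 D2 : set R) (g : R * R -> \bar R) :
  measurable D1 -> measurable D2 -> measurable_fun setT g ->
  (forall z, 0 <= g z)%E ->
  (\int[@lebesgue_measure R]_(x in D1) \int[@lebesgue_measure R]_(y in D2) g (x, y)
   = \int[@lebesgue_measure R]_(y in D2) \int[@lebesgue_measure R]_(x in D1) g (x, y))%E.
Proof.
move=> mD1 mD2 mg g0; pose G := g \_ (D1 `*` D2).
have mG : measurable_fun setT G.
  by apply/(measurable_restrictT _ _).1; [exact: measurableX|exact: measurable_funTS].
have G0 z : (0 <= G z)%E by exact: erestrict_ge0.
have := @fubini_tonelli _ _ _ _ R (@lebesgue_measure R) (@lebesgue_measure R) G mG G0.
have E1 x : (\int[@lebesgue_measure R]_y G (x, y) =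
    ((fun x => \int[@lebesgue_measure R]_(y in D2) g (x, y)) \_ D1) x)%E.
  rewrite patchE; case: ifPn => xD.
    rewrite [RHS]integral_mkcond; apply: eq_integral => y _.
    by rewrite /G !patchE in_setX xD.
  by apply: integral0_eq => y _; rewrite /G patchE in_setX (negbTE xD).
have E2 y : (\int[@lebesgue_measure R]_x G (x, y) =
    ((fun y => \int[@lebesgue_measure R]_(x in D1) g (x, y)) \_ D2) y)%E.
  rewrite patchE; case: ifPn => yD.
    rewrite [RHS]integral_mkcond; apply: eq_integral => x _.
    by rewrite /G !patchE in_setX yD andbT.
  by apply: integral0_eq => x _; rewrite /G patchE in_setX (negbTE yD) andbF.
under eq_integral do rewrite E1.
under [X in _ = X -> _]eq_integral do rewrite E2.
by rewrite -!integral_mkcond.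
Qed.

Lemma measurable_integral_fst (R : realType) (D : set R) (g : R * R -> \bar R) :
  measurable D -> measurable_fun setT g -> (forall z, 0 <= g z)%E ->
  measurable_fun setT (fun x => \int[@lebesgue_measure R]_(y in D) g (x, y))%E.
Proof.
move=> mD mg g0; pose G := g \_ (setT `*` D).
have mG : measurable_fun setT G.
  by apply/(measurable_restrictT _ _).1; [exact: measurableX|exact: measurable_funTS].
have G0 z : (0 <= G z)%E by exact: erestrict_ge0.
have := @measurable_fun_fubini_tonelli_F _ _ _ _ R (@lebesgue_measure R) G mG G0.
congr measurable_fun; apply/funext => x.
rewrite [RHS]integral_mkcond; apply: eq_integral => y _.
by rewrite /G !patchE in_setX in_setT.
Qed.

(** Division by the squared cosine turns the inequality into |tan (pi r)| < x, and [tan] is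
    increasing. At |r| = 1/2 the cosine vanishes and both sides are false. *)
Lemma cos_sin_half_shift_lt (R : realType) (x r : R) : 0 <= x -> `|r| <= 2^-1 ->
  (sin (pi * r) ^+ 2 < x ^+ 2 * cos (pi * r) ^+ 2) = (`|r| < atan x / pi).
Proof.
move=> x0 r1; have p0 := pi_gt0 R.
have [rE|rN] := eqVneq `|r| 2^-1.
  have c0 : cos (pi * r) = 0.
    by rewrite -cos_norm normrM (gtr0_norm p0) rE cos_pihalf.
  have s1 : sin (pi * r) ^+ 2 = 1 by rewrite sin2cos2 c0 expr0n subr0.
  rewrite c0 s1 expr0n mulr0 ltr10; apply/esym/negbTE.
  by rewrite -leNgt rE ler_pdivrMr// mulrC ltW// atan_ltpi2.
have {r1 rN} r1 : `|r| < 2^-1 by rewrite lt_neqAle rN.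
have /andP[r0 r2] : - 2^-1 < r < 2^-1 by rewrite -ltr_norml.
have c0 : 0 < cos (pi * r).
  by apply: cos_gt0_pihalf; apply/andP; split; nra.
have rI : pi * r \in `](- (pi / 2)), (pi / 2)[.
  by rewrite in_itv/=; apply/andP; split; nra.
have aI : atan x \in `](- (pi / 2)), (pi / 2)[ by rewrite in_itv/= atan_gtNpi2 atan_ltpi2.
have aI' : - atan x \in `](- (pi / 2)), (pi / 2)[ by rewrite -atanN in_itv/= atan_gtNpi2 atan_ltpi2.
rewrite (_ : (_ < _) = (tan (pi * r) ^+ 2 < x ^+ 2)); last first.
  by rewrite /tan expr_div_n ltr_pdivrMr ?exprn_gt0.
rewrite -(real_normK (num_real (tan (pi * r)))) ltr_pXn2r ?nnegrE// ltr_norml.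
rewrite -{1 2}[x]atanK -tanN !ltr_tan// ltr_pdivlMr//.
have -> : `|r| * pi = `|pi * r| by rewrite normrM (gtr0_norm p0) mulrC.
by rewrite ltr_norml.
Qed.

(** Centring t at 1/2 exchanges sine and cosine, so the set of admissible t is the open interval of
    radius atan x / pi about 1/2. *)
Lemma integral_cos_sin_lt (R : realType) (x k : R) : 0 <= x -> 0 <= k ->
  (\int[@lebesgue_measure R]_(t in `[0%R, 1%R])
    (if cos (pi * t) ^+ 2 < x ^+ 2 * sin (pi * t) ^+ 2 then k else 0)%R%:E
   = (k * (2 * atan x / pi))%:E)%E.
Proof.
move=> x0 k0; have p0 := pi_gt0 R.
have a0 : 0 <= atan x by rewrite -[leLHS]atan0 le_atan.
have a1 : atan x / pi < 2^-1 by rewrite ltr_pdivrMr// mulrC atan_ltpi2.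
have ap0 : 0 <= atan x / pi by rewrite divr_ge0// ltW.
pose A : set R := `](2^-1 - atan x / pi), (2^-1 + atan x / pi)[%classic.
transitivity (\int[@lebesgue_measure R]_(t in A) k%:E)%E.
  rewrite integral_mkcond [RHS]integral_mkcond; apply: eq_integral => t _.
  rewrite !patchE.
  have E : (t \in A) = (t \in (`[0, 1]%classic : set R)) &&
      (cos (pi * t) ^+ 2 < x ^+ 2 * sin (pi * t) ^+ 2).
    have -> : (t \in A) = (`|t - 2^-1| < atan x / pi).
      rewrite ltr_norml; apply/idP/andP => [/set_mem|[? ?]].
        by rewrite /A/= in_itv/= => /andP[? ?]; split; lra.
      by apply/mem_set; rewrite /A/= in_itv/=; apply/andP; split; lra.
    have -> : (t \in (`[0, 1]%classic : set R)) = (`|t - 2^-1| <= 2^-1).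
      rewrite ler_norml; apply/idP/andP => [/set_mem|[? ?]].
        by rewrite /= in_itv/= => /andP[? ?]; split; lra.
      by apply/mem_set; rewrite /= in_itv/=; apply/andP; split; lra.
    have [t1|t1] := boolP (`|t - 2^-1| <= 2^-1) => /=; last first.
      by apply/negbTE; move: t1; rewrite -!leNgt -ltNge; lra.
    rewrite -(cos_sin_half_shift_lt x0 t1).
    rewrite (_ : pi * (t - 2^-1) = pi * t - pi / 2); last by field.
    by rewrite sinBpihalf cosBpihalf sqrrN.
  by rewrite E; case: (t \in _) => //=; case: ifP.
rewrite /A integral_cst//= lebesgue_measure_itv/= lte_fin.
case: ifPn => [_|].
  by rewrite -EFinB -EFinM; congr EFin; ring.
(* An empty interval forces atan x = 0, and both sides vanish. *)
rewrite -leNgt => h; rewrite mule0; congr EFin.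
by rewrite (_ : 2 * atan x / pi = 0) ?mulr0//; lra.
Qed.

Lemma cos_2pi (R : realType) (t : R) :
  cos (2 * pi * t) = 2 * (cos (pi * t) * cos (pi * t)) - 1.
Proof.
rewrite (_ : 2 * pi * t = pi * t + pi * t); last ring.
by rewrite cosD -[sin _ * _]expr2 sin2cos2 expr2; ring.
Qed.

Lemma sin_2pi (R : realType) (t : R) :
  sin (2 * pi * t) = 2 * cos (pi * t) * sin (pi * t).
Proof.
rewrite (_ : 2 * pi * t = pi * t + pi * t); last ring.
by rewrite sinD; ring.
Qed.

(** On the torus (x + 1)^2 = 4 c^2 x and y^2 + y + 1 = (2 D + 1) y, with c = cos (pi t) and D = cos
    (2 pi u). The polynomial is thus 4 x y (c^2 (2 D + 1) - 1), where x y has modulus 1 and c^2 - 1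
    = -s^2. *)
Lemma norm_theorem11_poly (R : realType) (t u : R) :
  Normc.normc (('X + 1) ^+ 2 * ('Y ^+ 2 + 'Y + 1) - 4%:R * 'X * 'Y
    : {poly {poly R[i]}}).[cexp2pi t, cexp2pi u]
  = `|4 * (2 * cos (pi * t) ^+ 2 * cos (2 * pi * u) - sin (pi * t) ^+ 2)|.
Proof.
rewrite !hornerE /=.
have := sin_2pi t; have := cos_2pi t.
have := cos2Dsin2 (2 * pi * u); have := cos2Dsin2 (2 * pi * t).
have := cos2Dsin2 (pi * t).
set C := cos (2 * pi * t); set S := sin (2 * pi * t).
set D := cos (2 * pi * u); set E := sin (2 * pi * u).
set c := cos (pi * t); set s := sin (pi * t) => cs CS DE hC hS.
have ss : s * s = 1 - c * c by rewrite -cs; ring.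
have EE : E * E = 1 - D * D by rewrite -DE; ring.
clearbody C S D E c s.
(* [A1] and [A2] are the real and imaginary parts of (x + 1)^2, [A3] and [A4] those of y^2 + y +
   1. *)
have A1 : (C + 1) * (C + 1) - (S + 0) * (S + 0) = 4 * (c * c) * C.
  transitivity ((C + 1) * (C + 1) - 4 * (c * c) * (s * s)); first by rewrite hS; ring.
  by rewrite ss hC; ring.
have A2 : (C + 1) * (S + 0) + (S + 0) * (C + 1) = 4 * (c * c) * S.
  by rewrite hC; ring.
have A3 : D * D - E * E + D + 1 = D * (2 * D + 1) by rewrite EE; ring.
have A4 : D * E + E * D + E + 0 = E * (2 * D + 1) by ring.
rewrite A1 A2 A3 A4 -sqrtr_sqr; congr Num.sqrt.
rewrite [s ^+ 2]expr2 ss.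
set Re := (X in X ^+ 2 + _); set Im := (X in _ + X ^+ 2).
pose rho := 4 * (2 * c * c * D - (1 - c * c)).
have -> : Re = rho * (C * D - S * E) by rewrite /Re /rho; ring.
have -> : Im = rho * (C * E + S * D) by rewrite /Im /rho; ring.
transitivity (rho ^+ 2 * ((C ^+ 2 + S ^+ 2) * (D ^+ 2 + E ^+ 2))); first by ring.
by rewrite CS DE !mulr1.
Qed.

Lemma measurable_cos_fst (R : realType) (k : R) :
  measurable_fun setT (fun z : R * R => cos (k * z.1)).
Proof. exact: (measurableT_comp (measurable_cos_mul k) measurable_fst). Qed.

Lemma measurable_cos_snd (R : realType) (k : R) :
  measurable_fun setT (fun z : R * R => cos (k * z.2)).
Proof. exact: (measurableT_comp (measurable_cos_mul k) measurable_snd). Qed.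

Lemma measurable_sqrtr (R : realType) : measurable_fun [set: R] (@Num.sqrt R).
Proof. by apply: continuous_measurable_fun; exact: sqrt_continuous. Qed.

Section theorem11_tonelli.
Context {R : realType}.
Local Notation mu := (@lebesgue_measure R).
Local Notation I := (`[0%R, 1%R]%classic : set R).
Local Notation P := (`]0%R, +oo[%classic : set R).

Let f (z : R * R) := lne `|4 * (2 * cos (pi * z.1) ^+ 2 * cos (2 * pi * z.2)
  - sin (pi * z.1) ^+ 2)|%:E.

Let mf : measurable_fun setT f.
Proof.
apply: measurable_lne_comp; apply: measurableT_comp => //.
apply: measurable_funM => //; apply: measurable_funB.
  apply: measurable_funM; last exact: measurable_cos_snd.
  apply: measurable_funM => //; apply: measurable_funX.
  exact: measurable_cos_fst.
under eq_fun do rewrite sin2cos2.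
by apply: measurable_funB => //; apply: measurable_funX; exact: measurable_cos_fst.
Qed.

Let fC z : (f z <= (ln 12)%:E)%E.
Proof.
apply: lne_le_ln => //.
have := cos_le1 (2 * pi * z.2); have := cos_geN1 (2 * pi * z.2).
have := sqr_ge0 (cos (pi * z.1)); have := sqr_ge0 (sin (pi * z.1)).
have := cos2Dsin2 (pi * z.1).
set a := cos _ ^+ 2; set b := sin _ ^+ 2; set c := cos _ => h1 h2 h3 h4 h5.
by rewrite ler_norml; apply/andP; split; nra.
Qed.

(** The kernel of [cos_jensen_integral] at a = tau, with its condition multiplied by the squared
    cosine so that it makes sense for every t. *)
Let W (z : R * R) : R :=
  if (0 < z.2) && (cos (pi * z.1) ^+ 2 * (1 + z.2) < sin (pi * z.1) ^+ 2 * Num.sqrt z.2)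
  then z.2^-1 else 0.

Let mW : measurable_fun setT (fun z => (W z)%:E).
Proof.
apply/measurable_EFinP; apply: measurable_fun_ifT => //.
  apply: measurable_and.
    by apply: measurable_fun_ltr => //; exact: measurable_snd.
  apply: measurable_fun_ltr.
    apply: measurable_funM; last by apply: measurable_funD => //; exact: measurable_snd.
    by apply: measurable_funX; exact: measurable_cos_fst.
  apply: measurable_funM; last exact: (measurableT_comp (@measurable_sqrtr R) measurable_snd).
  under eq_fun do rewrite sin2cos2.
  by apply: measurable_funB => //; apply: measurable_funX; exact: measurable_cos_fst.
exact: (measurableT_comp (@measurable_invr R) measurable_snd).
Qed.

Let W0 z : (0 <= (W z)%:E)%E.
Proof.
rewrite lee_fin /W; case: ifP => // /andP[z0 _].
by rewrite invr_ge0 ltW.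
Qed.

(** The factor 4 c^2 is |-2 - 2 cos (2 pi t)|, so its logarithm is an instance of [lne_dist_cos];
    the remaining factor gives K(tau). At t = 1/2 the cosine vanishes and tau is not defined. *)
Let inner_u (t : R) : I t -> t != 2^-1 ->
  (\int[mu]_(u in I) f (t, u) =
   lne_dist_cos (- 2) t + (4^-1)%:E * \int[mu]_(w in P) (W (t, w))%:E)%E.
Proof.
rewrite /= in_itv/= => /andP[t0 t1] t2; have p0 := pi_gt0 R.
pose c := cos (pi * t); pose s := sin (pi * t).
have c0 : c != 0.
  apply: contra_neq t2 => c0.
  have : pi * t = pi / 2.
    apply: cos_inj; rewrite ?in_itv/= ?cos_pihalf//.
      by apply/andP; split; nra.
    by apply/andP; split; lra.
  by move/mulfI; apply; rewrite gt_eqF.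
have cc : 0 < c ^+ 2 by rewrite exprn_even_gt0.
have a0 : 0 <= s ^+ 2 / c ^+ 2 by rewrite divr_ge0 ?sqr_ge0.
have E1 : lne_dist_cos (- 2) t = (ln (4 * c ^+ 2))%:E.
  rewrite /lne_dist_cos cos_2pi -/c.
  rewrite (_ : _ - _ = - (4 * c ^+ 2)); last by ring.
  by rewrite normrN gtr0_norm ?lne_EFin// mulr_gt0.
have E2 u : f (t, u) = (lne_dist_cos (- 2) t + lne_dist_cos (s ^+ 2 / c ^+ 2) u)%E.
  have -> : f (t, u) = lne `|4 * (2 * c ^+ 2 * cos (2 * pi * u) - s ^+ 2)|%:E by [].
  have e : lne_dist_cos (- 2) t = lne (4 * c ^+ 2)%:E.
    by rewrite E1 lne_EFin// mulr_gt0.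
  rewrite e /lne_dist_cos -lneM_ge0//; last by rewrite ltW// mulr_gt0.
  congr (lne _%:E).
  have q0 : 0 < 4 * c ^+ 2 by rewrite mulr_gt0.
  rewrite -(gtr0_norm q0) -normrM -normrN.
  by congr (`|_|); field.
under eq_integral do rewrite E2 E1.
rewrite (@integral_unit_bddD _ (fun=> (ln (4 * c ^+ 2))%:E) _ (ln (4 * c ^+ 2))
  (ln (`|s ^+ 2 / c ^+ 2| + 2)))//; last 2 first.
- exact: measurable_funTS (measurable_lne_dist_cos _).
- by move=> u; exact: lne_dist_cos_le.
rewrite integral_unit_cst -/(cos_jensen _) -E1 cos_jensen_integral//.
congr (_ + _ * _)%E; apply: eq_integral => w.
rewrite inE/= in_itv/= andbT /W /= => -> /=; rewrite -/c -/s.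
by rewrite mulrAC ltr_pdivlMr// [X in X < _]mulrC.
Qed.

Let inner_t (w : R) : P w -> (\int[mu]_(t in I) (W (t, w))%:E =
  ((2 / pi) * (w^-1 * atan (Num.sqrt (Num.sqrt w / (1 + w)))))%:E)%E.
Proof.
rewrite /= in_itv/= andbT => w0.
set x := Num.sqrt (_ / _).
have xx : x ^+ 2 = Num.sqrt w / (1 + w).
  by rewrite sqr_sqrtr// divr_ge0 ?sqrtr_ge0//; lra.
transitivity (\int[mu]_(t in I)
    (if cos (pi * t) ^+ 2 < x ^+ 2 * sin (pi * t) ^+ 2 then w^-1 else 0)%:E)%E.
  apply: eq_integral => t _; rewrite /W /= w0 /=.
  have w1 : 0 < 1 + w by lra.
  have E : Num.sqrt w / (1 + w) * sin (pi * t) ^+ 2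
      = sin (pi * t) ^+ 2 * Num.sqrt w / (1 + w) by ring.
  by rewrite xx E ltr_pdivlMr.
rewrite integral_cos_sin_lt ?sqrtr_ge0 ?invr_ge0 ?(ltW w0)//.
by congr EFin; ring.
Qed.

(** Tonelli for [C - f] brings u inside, and Tonelli for [W] then exchanges t and w. The finiteness
    hypothesis makes [Wt] integrable, so that the t-integral of the sum splits into K(-2) = 0 and
    the arctangent integral. *)
Lemma mahler_measure_theorem11_atan :
  (\int[mu]_(w in P) (w^-1 * atan (Num.sqrt (Num.sqrt w / (1 + w))))%:E < +oo)%E ->
  mahler_measure
    (('X + 1) ^+ 2 * ('Y ^+ 2 + 'Y + 1) - 4%:R * 'X * 'Y : {poly {poly R[i]}})
  = ((2 * pi)^-1%:E *
     \int[mu]_(w in P) (w^-1 * atan (Num.sqrt (Num.sqrt w / (1 + w))))%:E)%E.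
Proof.
move=> fin; have p0 := pi_gt0 R.
have mP : measurable P by exact: measurable_itv.
have mI : measurable I by exact: measurable_itv.
pose C : R := ln 12; pose g z := (C%:E - f z)%E.
have mg : measurable_fun setT g by apply: emeasurable_funB => //; exact: measurable_cst.
have g0 z : (0 <= g z)%E by rewrite sub_EFin_ge0.
have mgs : measurable_fun setT (fun z : R * R => g (z.2, z.1)).
  exact: (measurableT_comp mg (measurable_swap (T1 := R) (T2 := R))).
have mfst (t : R) : measurable_fun setT (fun u : R => f (t, u)).
  exact: (measurableT_comp mf (measurable_pair1 t)).
have msnd (u : R) : measurable_fun setT (fun t : R => f (t, u)).
  exact: (measurableT_comp mf (measurable_pair2 u)).
pose G t := (\int[mu]_(u in I) g (t, u))%E.
have G0 t : (0 <= G t)%E by apply: integral_ge0.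
have mG : measurable_fun setT G by exact: measurable_integral_fst.
have mGI : measurable_fun I G by exact: measurable_funTS.
have FE t : (\int[mu]_(u in I) f (t, u) = C%:E - G t)%E.
  by apply: integral_unit_bdd => //; exact: measurable_funTS (mfst t).
have -> : (mahler_measure (('X + 1) ^+ 2 * ('Y ^+ 2 + 'Y + 1) - 4%:R * 'X * 'Y :
    {poly {poly R[i]}}) = \int[mu]_(u in I) \int[mu]_(t in I) f (t, u))%E.
  apply: eq_integral => u _; apply: eq_integral => t _.
  by rewrite norm_theorem11_poly.
transitivity (\int[mu]_(u in I) (C%:E - \int[mu]_(t in I) g (t, u)))%E.
  apply: eq_integral => u _; apply: (@integral_unit_bdd _ (fun t => f (t, u))) => //.
  exact: measurable_funTS (msnd u).
rewrite integral_unit_sub; last 2 first.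
- exact: measurable_funTS (measurable_integral_fst mI mgs (fun z => g0 (z.2, z.1))).
- by move=> u; apply: integral_ge0.
rewrite -(integral_swap mI mI mg g0) -(integral_unit_sub C mGI G0).
pose Wt t := ((4^-1)%:E * \int[mu]_(w in P) (W (t, w))%:E)%E.
have mWt : measurable_fun setT Wt.
  by apply: emeasurable_funM => //; exact: (measurable_integral_fst mP mW W0).
have Wt0 t : (0 <= Wt t)%E by apply: mule_ge0; [rewrite lee_fin|apply: integral_ge0].
have ml := measurable_lne_dist_cos (- 2 : R).
transitivity (\int[mu]_(t in I) (lne_dist_cos (- 2) t + Wt t))%E.
  (* The exceptional point of [inner_u] is a null set. *)
  have mD : measurable (I `\ 2^-1) by apply: measurableD.
  rewrite -(@integral_setD1 _ _ 2^-1)//; last first.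
    by apply: emeasurable_funB; [exact: measurable_cst|exact: measurable_funTS].
  rewrite -[RHS](@integral_setD1 _ _ 2^-1)//; last first.
    by apply: measurable_funTS; exact: emeasurable_funD.
  apply: eq_integral => t; rewrite inE => -[It /= /eqP t2].
  by rewrite -FE inner_u.
have intW : (\int[mu]_(t in I) Wt t = (2 * pi)^-1%:E *
     \int[mu]_(w in P) (w^-1 * atan (Num.sqrt (Num.sqrt w / (1 + w))))%:E)%E.
  rewrite ge0_integralZl_EFin//; last 2 first.
  - by move=> t _; apply: integral_ge0.
  - exact: measurable_funTS (measurable_integral_fst mP mW W0).
  rewrite (integral_swap mI mP mW W0).
  transitivity ((4^-1)%:E * ((2 / pi)%:E * \int[mu]_(w in P)
      (w^-1 * atan (Num.sqrt (Num.sqrt w / (1 + w))))%:E))%E; last first.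
    have e : 4^-1 * (2 / pi) = (2 * pi)^-1 :> R.
      by rewrite invfM mulrA; congr (_ * _); lra.
    by rewrite muleA -EFinM e.
  congr (_ * _)%E; rewrite -ge0_integralZl_EFin//; last 3 first.
  - move=> w; rewrite /= in_itv/= andbT => w0.
    by rewrite lee_fin mulr_ge0 ?invr_ge0 ?(ltW w0)// -[leLHS]atan0 le_atan ?sqrtr_ge0.
  - apply: measurable_funTS; apply/measurable_EFinP; apply: measurable_funM.
      exact: measurable_invr.
    apply: (measurableT_comp (f := @atan R)).
      by apply: continuous_measurable_fun => x; exact: continuous_atan.
    apply: (measurableT_comp (@measurable_sqrtr R)); apply: measurable_funM.
      exact: measurable_sqrtr.
    apply: (measurableT_comp (@measurable_invr R)).
    exact: measurable_funD.
  - by rewrite divr_ge0// ltW.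
  by apply: eq_integral => w /set_mem Pw; rewrite inner_t// EFinM.
(* Integrability is drawn from the value K(-2) = 0: it makes the integral of the non-negative
   function [c - lne_dist_cos (- 2)] finite. *)
have il : mu.-integrable I (lne_dist_cos (- 2)).
  pose c : R := ln (`|- 2| + 2).
  have lc t : (lne_dist_cos (- 2) t <= c%:E)%E by exact: lne_dist_cos_le.
  have mh : measurable_fun I (fun t => c%:E - lne_dist_cos (- 2) t)%E.
    by apply: emeasurable_funB; [exact: measurable_cst|exact: measurable_funTS].
  have ic : mu.-integrable I (fun=> c%:E).
    by apply/integrableP; split => //=; rewrite integral_cst//= lebesgue_measure_unit_itv mule1 ltry.
  have ih : mu.-integrable I (fun t => c%:E - lne_dist_cos (- 2) t)%E.
    apply/integrableP; split => //.
    under eq_integral do rewrite gee0_abs ?sub_EFin_ge0//.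
    have := integral_unit_bdd (measurable_funTS ml) lc.
    rewrite -/(cos_jensen (- 2)) cos_jensen_eq0 ?normrN ?ger0_norm//.
    by case: (\int[mu]_(x in I) _)%E => // r _; exact: ltry.
  have -> : lne_dist_cos (- 2) = (fun t => c%:E - (c%:E - lne_dist_cos (- 2) t))%E.
    apply/funext => t; case: (lne_dist_cos (- 2) t) (lc t) => [r| |] //= _.
    by rewrite -EFinD; congr EFin; ring.
  exact: integrableB.
have iW : mu.-integrable I Wt.
  apply/integrableP; split; first exact: measurable_funTS.
  under eq_integral do rewrite gee0_abs//.
  by rewrite intW lte_mul_pinfty// lee_fin invr_ge0 mulr_ge0// ltW.
rewrite integralD// -/(cos_jensen (- 2)) cos_jensen_eq0 ?normrN ?ger0_norm//.
by rewrite add0e intW.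
Qed.

End theorem11_tonelli.

(** * Gamma and beta integrals *)

Section gamma_integral.
Context {R : realType}.
Local Notation mu := (@lebesgue_measure R).
Local Notation P := (`]0%R, +oo[%classic : set R).
Implicit Types a s x y w : R.

(** Euler's integral with extended values, so that Tonelli arguments precede the proof of
    finiteness; [GammaE] returns to [Gamma]. *)
Definition gamma_int s := (\int[mu]_(x in P) (x `^ (s - 1) * expR (- x))%:E)%E.

(** The diagonal beta value B(s, s) as an integral over the half-line, the form in which the powers
    of X(w) arise. *)
Definition beta_int s :=
  (\int[mu]_(w in P) (w `^ (s - 1) * (1 + w) `^ (- (2 * s)))%:E)%E.

Lemma measurable_powR_expR a s : measurable_fun setT
  (fun x : R => (x `^ s * expR (- (a * x)))%:E).
Proof.
apply/measurable_EFinP; apply: measurable_funM; first exact: measurable_powR.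
apply: (measurableT_comp (@measurable_expR R)).
have mM : measurable_fun [set: R] (fun x : R => a * x) by exact: mulrl_measurable.
exact: measurable_funN.
Qed.

Lemma measurable_gamma_integrand s (D : set R) :
  measurable_fun D (fun x : R => (x `^ (s - 1) * expR (- x))%:E).
Proof.
apply: measurable_funTS; have := measurable_powR_expR 1 (s - 1).
by under eq_fun do rewrite mul1r.
Qed.

Lemma gamma_int_ge0 s : (0 <= gamma_int s)%E.
Proof. by apply: integral_ge0 => x _; rewrite lee_fin mulr_ge0 ?powR_ge0 ?expR_ge0. Qed.

Lemma gamma_int_scale s a : 0 < a ->
  (\int[mu]_(x in P) (x `^ (s - 1) * expR (- (a * x)))%:E
   = (a `^ (- s))%:E * gamma_int s)%E.
Proof.
move=> a0.
have m1 := measurable_gamma_integrand s.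
rewrite /gamma_int [in RHS](@ge0_integral_affine _ a 0)//; last first.
  by move=> x _; rewrite lee_fin mulr_ge0 ?powR_ge0 ?expR_ge0.
have -> : [set x | P (a * x + 0)] = P.
  by apply/seteqP; split => x /=; rewrite !in_itv/= !andbT addr0 pmulr_rgt0.
rewrite muleA -EFinM -ge0_integralZl_EFin//; last 3 first.
- by move=> x _; rewrite lee_fin mulr_ge0 ?powR_ge0 ?expR_ge0.
- exact: measurable_funTS (measurable_affine_comp a 0 (m1 setT)).
- by rewrite mulr_ge0 ?powR_ge0 ?ltW.
apply: eq_integral => x; rewrite inE/= in_itv/= andbT => x0.
rewrite addr0 -EFinM; congr EFin.
have h1 : a != 0 by rewrite gt_eqF.
have h2 : a `^ s != 0 by rewrite gt_eqF// powR_gt0.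
have E : a `^ (- s) * a * a `^ (s - 1) = 1.
  rewrite powRN powRB; last by rewrite h1 implybT.
  by rewrite (powRr1 (ltW a0)); field; rewrite h1 h2.
rewrite (powRM _ (ltW a0) (ltW x0)).
transitivity (a `^ (- s) * a * a `^ (s - 1) * (x `^ (s - 1) * expR (- (a * x)))).
  by rewrite E mul1r.
by ring.
Qed.

Lemma integral_expRN y : (\int[mu]_(x in `[y, +oo[) (expR (- x))%:E = (expR (- y))%:E)%E.
Proof.
have dF x : is_derive x (1 : R) (fun x : R => - expR (- x)) (expR (- x)).
  have dN : is_derive x (1 : R) (fun x : R => - x) (- 1) by exact: is_deriveN.
  have := is_deriveN (is_derive1_comp (is_derive_expR (- x)) dN).
  by rewrite mulrN1 opprK.
have cN : continuous (fun x : R => expR (- x)).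
  by move=> x; apply: continuous_comp; [exact: opp_continuous|exact: continuous_expR].
rewrite (@ge0_continuous_FTC2y _ (fun x => expR (- x)) (fun x => - expR (- x)) y 0).
- by rewrite -EFinD sub0r opprK.
- by move=> x _; exact: expR_ge0.
- by apply: continuous_subspaceT => x; exact: cN.
- by rewrite -oppr0; apply: cvgN; exact: cvgr_expR.
- by move=> x _; exact: ex_derive.
- by apply: cvg_at_right_filter; apply: cvgN; exact: cN.
- by move=> x _; rewrite derive1E; exact: derive_val.
Qed.

(* [x^s] is the integral of [s y^(s-1)] over [0 < y <= x]; exchanging the two
   integrals avoids the boundary terms of an integration by parts. *)
Lemma gamma_int_succ s : 0 < s -> (gamma_int (s + 1) = s%:E * gamma_int s)%E.
Proof.
move=> s0.
pose g (z : R * R) : \bar R :=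
  (if z.2 <= z.1 then s * z.2 `^ (s - 1) * expR (- z.1) else 0)%:E.
have mP : measurable P by exact: measurable_itv.
have mg : measurable_fun setT g.
  apply/measurable_EFinP; apply: measurable_fun_ifT => //.
    by apply: measurable_fun_ler; [exact: measurable_snd|exact: measurable_fst].
  apply: measurable_funM.
    apply: measurable_funM => //.
    exact: (measurableT_comp (measurable_powR (s - 1)) measurable_snd).
  apply: (measurableT_comp (@measurable_expR R)); apply: measurable_funN.
  exact: measurable_fst.
have g0 z : (0 <= g z)%E.
  by rewrite lee_fin; case: ifP => // _; rewrite !mulr_ge0 ?powR_ge0 ?expR_ge0// ltW.
have mpow D : measurable D -> measurable_fun D (fun y : R => (s * y `^ (s - 1))%:E).
  move=> mD; apply/measurable_EFinP/measurable_funM => //.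
  by apply: measurable_funTS; exact: measurable_powR.
have mexp D : measurable D -> measurable_fun D (fun x : R => (expR (- x))%:E).
  move=> mD; apply: measurable_funTS; apply/measurable_EFinP.
  apply: (measurableT_comp (@measurable_expR R)); exact: oppr_measurable.
transitivity (\int[mu]_(x in P) \int[mu]_(y in P) g (x, y))%E.
  apply: eq_integral => x; rewrite inE/= in_itv/= andbT => x0.
  rewrite addrK mulrC EFinM -integral_powR// -ge0_integralZl_EFin ?expR_ge0//; last 2 first.
  - by move=> y _; rewrite lee_fin mulr_ge0 ?powR_ge0 ?ltW.
  - exact: mpow.
  rewrite integral_mkcond [RHS]integral_mkcond; apply: eq_integral => y _.
  rewrite !patchE /g /=.
  have -> : (y \in (`]0, x]%classic : set R)) = (y \in P) && (y <= x).
    by apply/idP/andP; rewrite !inE/= !in_itv/= ?andbT; [move=> /andP[]|move=> [-> ->]].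
  by case: (y \in P) => //=; case: ifP => //= _; rewrite -EFinM mulrC.
rewrite (integral_swap mP mP mg g0).
rewrite -ge0_integralZl_EFin ?(ltW s0)//; last 2 first.
- by move=> x _; rewrite lee_fin mulr_ge0 ?powR_ge0 ?expR_ge0.
- exact: measurable_gamma_integrand.
apply: eq_integral => y; rewrite inE/= in_itv/= andbT => y0.
rewrite -EFinM mulrA EFinM -integral_expRN -ge0_integralZl_EFin//; last 2 first.
- exact: mexp.
- by rewrite mulr_ge0 ?powR_ge0 ?ltW.
rewrite [LHS]integral_mkcond [RHS]integral_mkcond; apply: eq_integral => x _.
rewrite !patchE /g /=.
have -> : (x \in (`[y, +oo[%classic : set R)) = (x \in P) && (y <= x).
  apply/idP/andP; rewrite !inE/= !in_itv/= ?andbT; last by move=> [].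
  by move=> yx; split => //; exact: lt_le_trans yx.
by case: (x \in P) => //=; case: ifP => //= _; rewrite -EFinM.
Qed.

Lemma gamma_int1 : gamma_int (1 : R) = 1%E.
Proof.
rewrite /gamma_int integral_itv_obnd_cbnd; last first.
  exact: measurable_gamma_integrand.
under eq_integral do rewrite subrr powRr0 mul1r.
by rewrite integral_expRN oppr0 expR0.
Qed.

Lemma gamma_int_nat_lty (m : nat) : (gamma_int (m.+1%:R : R) < +oo)%E.
Proof.
elim: m => [|m IH]; first by rewrite gamma_int1 ltry.
by rewrite -natr1 gamma_int_succ ?ltr0n// lte_mul_pinfty ?lee_fin.
Qed.

(** The functional equation moves the question to s + 1, where the power is x^s with s > 0. There
    x^s <= 1 + x^m for an integer m >= s, which leaves integer arguments. *)
Lemma gamma_int_lty s : 0 < s -> (gamma_int s < +oo)%E.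
Proof.
move=> s0.
suff H : (gamma_int (s + 1) < +oo)%E.
  move: H; rewrite gamma_int_succ//; case: (gamma_int s) (gamma_int_ge0 s) => [r| |]//.
    by move=> _ _; rewrite ltry.
  by rewrite gt0_muley ?lte_fin.
have mm r := @measurable_gamma_integrand r P.
have nn (r x : R) : (0 <= (x `^ (r - 1) * expR (- x))%:E)%E.
  by rewrite lee_fin mulr_ge0 ?powR_ge0 ?expR_ge0.
have [m sm] : exists m : nat, s <= m%:R.
  by exists (Num.truncn s).+1; rewrite ltW// truncnS_gt.
apply: (@le_lt_trans _ _ (gamma_int (1 : R) + gamma_int (m.+1%:R : R))%E); last first.
  by apply: lte_add_pinfty; [rewrite gamma_int1 ltry|exact: gamma_int_nat_lty].
rewrite /gamma_int -ge0_integralD//; [|exact: mm|exact: mm].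
apply: ge0_le_integral => //; [exact: mm|by apply: emeasurable_funD; exact: mm|].
move=> x; rewrite /= in_itv/= andbT => x0.
rewrite -EFinD lee_fin -mulrDl ler_wpM2r ?expR_ge0// subrr powRr0 addrK -natr1 addrK.
have [x1|x1] := leP x 1.
  rewrite (@le_trans _ _ 1)// ?lerDl ?powR_ge0//.
  have := @ge0_ler_powR _ s (ltW s0) x 1; rewrite powR1; apply => //;
    by rewrite nnegrE ?ler01// ltW.
by rewrite (@le_trans _ _ (x `^ m%:R))// ?lerDr// ler_powR// ltW.
Qed.

(** After passing to s + 1, the bound x^s >= 1 for x >= 1 leaves at least the integral of exp (-x)
    over [1, +oo[, which is exp (-1). *)
Lemma gamma_int_gt0 s : 0 < s -> (0 < gamma_int s)%E.
Proof.
move=> s0.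
suff H : (0 < gamma_int (s + 1))%E.
  move: H; rewrite gamma_int_succ// !lt0e => /andP[h _]; rewrite gamma_int_ge0 andbT.
  by apply: contra_neq h => ->; rewrite mule0.
apply: (@lt_le_trans _ _ (expR (- 1))%:E); first by rewrite lte_fin expR_gt0.
rewrite -integral_expRN /gamma_int.
apply: (@le_trans _ _ (\int[mu]_(x in `[1%R, +oo[) (x `^ (s + 1 - 1) * expR (- x))%:E)%E).
  apply: ge0_le_integral => //.
  - apply: measurable_funTS; apply/measurable_EFinP.
    by apply: (measurableT_comp (@measurable_expR R)); exact: oppr_measurable.
  - exact: measurable_gamma_integrand.
  - move=> x; rewrite /= in_itv/= andbT => x1; rewrite lee_fin addrK.
    by rewrite ler_peMl ?expR_ge0// -[leLHS](powRr0 x) ler_powR// ltW.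
apply: ge0_subset_integral => //.
- exact: measurable_gamma_integrand.
- by move=> x _; rewrite lee_fin mulr_ge0 ?powR_ge0 ?expR_ge0.
- by move=> x /=; rewrite !in_itv/= !andbT; exact: lt_le_trans.
Qed.

Lemma expRN_add1M x w : expR (- ((1 + w) * x)) = expR (- x) * expR (- (x * w)).
Proof. by rewrite -expRD; congr expR; ring. Qed.

(** The substitution y = x w in the second factor turns the product into the double integral of x^(2
    s - 1) w^(s - 1) exp (-(1 + w) x). Integrating over x first gives (1 + w)^(-2 s) Gamma (2 s). *)
Lemma gamma_int_sqr s : 0 < s ->
  (gamma_int s * gamma_int s = beta_int s * gamma_int (2 * s))%E.
Proof.
move=> s0.
have mP : measurable P by exact: measurable_itv.
have fs : gamma_int s = (fine (gamma_int s))%:E.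
  by rewrite fineK// ge0_fin_numE ?gamma_int_lty ?gamma_int_ge0.
have s20 : 0 < 2 * s by rewrite mulr_gt0.
have fs2 : gamma_int (2 * s) = (fine (gamma_int (2 * s)))%:E.
  by rewrite fineK// ge0_fin_numE ?gamma_int_lty ?gamma_int_ge0.
have mm r := @measurable_gamma_integrand r P.
have nn (r x : R) : (0 <= (x `^ (r - 1) * expR (- x))%:E)%E.
  by rewrite lee_fin mulr_ge0 ?powR_ge0 ?expR_ge0.
pose g (z : R * R) : \bar R :=
  (z.1 `^ (2 * s - 1) * z.2 `^ (s - 1) * expR (- ((1 + z.2) * z.1)))%:E.
have mg : measurable_fun setT g.
  apply/measurable_EFinP; apply: measurable_funM.
    apply: measurable_funM.
      exact: (measurableT_comp (measurable_powR _) measurable_fst).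
    exact: (measurableT_comp (measurable_powR _) measurable_snd).
  apply: (measurableT_comp (@measurable_expR R)); apply: measurable_funN.
  apply: measurable_funM; last exact: measurable_fst.
  by apply: measurable_funD => //; exact: measurable_snd.
have g0 z : (0 <= g z)%E by rewrite lee_fin !mulr_ge0 ?powR_ge0 ?expR_ge0.
transitivity (\int[mu]_(x in P) \int[mu]_(w in P) g (x, w))%E.
  rewrite {2}fs muleC -ge0_integralZl_EFin ?fine_ge0 ?gamma_int_ge0//; last exact: mm.
  apply: eq_integral => x; rewrite inE/= in_itv/= andbT => x0.
  rewrite -fs muleC.
  transitivity ((x `^ (2 * s - 1) * expR (- x))%:E *
      \int[mu]_(w in P) (w `^ (s - 1) * expR (- (x * w)))%:E)%E.
    rewrite gamma_int_scale// muleA -EFinM; congr (_%:E * _)%E.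
    rewrite mulrAC -powRD ?(gt_eqF x0) ?implybT//; congr (_ `^ _ * _); ring.
  rewrite -ge0_integralZl_EFin ?mulr_ge0 ?powR_ge0 ?expR_ge0//; last 2 first.
  - by move=> w _; rewrite lee_fin mulr_ge0 ?powR_ge0 ?expR_ge0.
  - exact: measurable_funTS (measurable_powR_expR _ _).
  apply: eq_integral => w _; rewrite /g/= -EFinM; congr EFin.
  by rewrite expRN_add1M; ring.
rewrite (integral_swap mP mP mg g0).
rewrite fs2 muleC /beta_int -ge0_integralZl_EFin ?fine_ge0 ?gamma_int_ge0//; last 2 first.
- by move=> w _; rewrite lee_fin mulr_ge0 ?powR_ge0.
- apply: measurable_funTS; apply/measurable_EFinP; apply: measurable_funM.
    exact: measurable_powR.
  have m1 : measurable_fun [set: R] (fun w : R => 1 + w) by exact: measurable_funD.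
  exact: (measurableT_comp (measurable_powR _) m1).
apply: eq_integral => w; rewrite inE/= in_itv/= andbT => w0.
have w1 : 0 < 1 + w by rewrite addr_gt0.
transitivity ((w `^ (s - 1))%:E *
    \int[mu]_(x in P) (x `^ (2 * s - 1) * expR (- ((1 + w) * x)))%:E)%E; last first.
  rewrite gamma_int_scale// {1}fs2 -!EFinM; congr EFin.
  by rewrite mulrA mulrC.
rewrite -ge0_integralZl_EFin ?powR_ge0//; last 2 first.
- by move=> x _; rewrite lee_fin mulr_ge0 ?powR_ge0 ?expR_ge0.
- exact: measurable_funTS (measurable_powR_expR _ _).
by apply: eq_integral => x _; rewrite /g/= -EFinM mulrA [_ * w `^ _]mulrC.
Qed.

End gamma_integral.

(** * The arctangent series *)

Definition atan_rem (R : realType) (N : nat) (x : R) : R :=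
  atan x - \sum_(n < N) (-1) ^+ n / (2 * n + 1)%:R * x ^+ (2 * n + 1).

Lemma is_derive_monomial (R : realType) (c x : R) (n : nat) :
  is_derive x (1 : R) (fun x : R => c * x ^+ n.+1) (c * (n.+1%:R * x ^+ n)).
Proof.
have dX : is_derive x (1 : R) ((@id R) ^+ n.+1) (n.+1%:R * x ^+ n).
  apply: is_derive_eq.
  by rewrite /GRing.scale/= mulr1.
have -> : (fun x : R => c * x ^+ n.+1) = c \*: ((@id R) ^+ n.+1).
  by apply/funext => y; rewrite /= exprfctE.
exact: (is_deriveZ c dX).
Qed.

(** The derivative is the remainder of the geometric series of 1 / (1 + x^2) after N terms. *)
Lemma is_derive_atan_rem (R : realType) (N : nat) (x : R) :
  is_derive x (1 : R) (@atan_rem R N) ((- x ^+ 2) ^+ N / (1 + x ^+ 2)).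
Proof.
elim: N => [|N IH].
  rewrite expr0 div1r (_ : @atan_rem R 0 = atan); first exact: is_derive1_atan.
  by apply/funext => y; rewrite /atan_rem big_ord0 subr0.
have -> : @atan_rem R N.+1 = (@atan_rem R N \-
    (fun x => (-1) ^+ N / (2 * N).+1%:R * x ^+ (2 * N).+1))%R.
  by apply/funext => y; rewrite /atan_rem big_ord_recr/= opprD addrA addn1.
have -> : (- x ^+ 2) ^+ N.+1 / (1 + x ^+ 2) = (- x ^+ 2) ^+ N / (1 + x ^+ 2)
    - (-1) ^+ N / (2 * N).+1%:R * ((2 * N).+1%:R * x ^+ (2 * N)).
  have x0 : 1 + x ^+ 2 != 0 by rewrite gt_eqF// ltr_pwDl// sqr_ge0.
  have n0 : (2 * N).+1%:R != 0 :> R by rewrite pnatr_eq0.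
  rewrite mulrA divfK// exprM -exprMn mulN1r.
  apply: (mulIf x0); rewrite mulrBl !divfK// exprS; ring.
exact: is_deriveB IH (is_derive_monomial _ _ _).
Qed.

(** By the mean value theorem the remainder is x times its derivative at some y in ]0, x[, and that
    derivative is at most y^(2 N) in absolute value. *)
Lemma atan_rem_le (R : realType) (N : nat) (x : R) : 0 <= x ->
  `|atan_rem N x| <= x ^+ (2 * N + 1).
Proof.
rewrite le_eqVlt => /predU1P[<-|x0].
  rewrite /atan_rem atan0 big1 ?subr0 ?normr0 ?exprn_ge0// => n _.
  by rewrite addn1 expr0n mulr0.
have cf : {within `[0, x], continuous (@atan_rem R N)}.
  apply: continuous_subspaceT => z; apply: differentiable_continuous.
  by apply/derivable1_diffP; apply: ex_derive; exact: is_derive_atan_rem.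
have [y /[!in_itv]/= /andP[y0 yx]] := MVT x0 (fun z _ => is_derive_atan_rem N z) cf.
have -> : atan_rem N 0 = 0 :> R.
  rewrite /atan_rem atan0 big1 ?subr0// => n _.
  by rewrite addn1 expr0n mulr0.
rewrite !subr0 => ->.
rewrite normrM (gtr0_norm x0) addn1 [x ^+ _.+1]exprSr ler_pM2r// normrM normrX normrN normfV.
have y1 : 1 <= `|1 + y ^+ 2| by rewrite ger0_norm ?lerDl ?sqr_ge0// addr_ge0// sqr_ge0.
rewrite ger0_norm ?sqr_ge0// exprM ler_pdivrMr; last exact: lt_le_trans y1.
apply: (@le_trans _ _ ((y ^+ 2) ^+ N * `|1 + y ^+ 2|)).
  by rewrite ler_peMr// exprn_ge0// sqr_ge0.
rewrite ler_wpM2r// lerXn2r ?nnegrE ?sqr_ge0//.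
by rewrite lerXn2r ?nnegrE ?(ltW y0) ?(ltW x0) ?(ltW yx).
Qed.

(** * Termwise integration of the arctangent *)

Section beta_series.
Context {R : realType}.
Local Notation mu := (@lebesgue_measure R).
Local Notation P := (`]0%R, +oo[%classic : set R).

Lemma GammaE (s : R) : 0 < s -> gamma_int s = (Gamma s)%:E.
Proof.
by move=> s0; rewrite /Gamma /Rintegral fineK// ge0_fin_numE ?gamma_int_lty ?gamma_int_ge0.
Qed.

Lemma Gamma_gt0 (s : R) : 0 < s -> 0 < Gamma s.
Proof. by move=> s0; rewrite -lte_fin -GammaE// gamma_int_gt0. Qed.

Lemma GammaS (s : R) : 0 < s -> Gamma (s + 1) = s * Gamma s.
Proof.
move=> s0; have s1 : 0 < s + 1 by rewrite addr_gt0.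
by apply: EFin_inj; rewrite -GammaE// gamma_int_succ// GammaE// EFinM.
Qed.

Lemma beta_int_ge0 (s : R) : (0 <= beta_int s)%E.
Proof. by apply: integral_ge0 => w _; rewrite lee_fin mulr_ge0 ?powR_ge0. Qed.

Lemma beta_intE (s : R) : 0 < s -> beta_int s = (Beta s s)%:E.
Proof.
move=> s0; have s20 : 0 < 2 * s by rewrite mulr_gt0.
have := gamma_int_sqr s0; rewrite !GammaE// /Beta (_ : s + s = 2 * s); last by ring.
have G0 := Gamma_gt0 s20.
have := beta_int_ge0 s; case: (beta_int s) => [b| |]//.
  by move=> _; rewrite -!EFinM => -[->]; rewrite mulfK// gt_eqF.
by move=> _; rewrite gt0_mulye.
Qed.

Lemma BetaS (s : R) : 0 < s ->
  Beta (s + 1) (s + 1) = s / (2 * (2 * s + 1)) * Beta s s.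
Proof.
move=> s0; rewrite /Beta GammaS//.
have s1 : 0 < s + s by rewrite addr_gt0.
rewrite (_ : s + 1 + (s + 1) = s + s + 1 + 1); last by ring.
have s2 : 0 < s + s + 1 by rewrite addr_gt0.
rewrite !GammaS//; have := Gamma_gt0 s1; set g := Gamma (s + s) => g0.
by field; rewrite ?gt_eqF//; lra.
Qed.

(* The inverse square root of [sqrt w + 1 / sqrt w]: the times [t] in [0, 1] with
   [tan (pi t) ^+ 2 > sqrt w + 1 / sqrt w] form an interval of length
   [2 * atan (xw w) / pi]. *)
Definition xw (w : R) : R := Num.sqrt (Num.sqrt w / (1 + w)).

Lemma xw_ge0 w : 0 <= xw w. Proof. exact: sqrtr_ge0. Qed.

Lemma xw_sqr_le w : 0 < w -> xw w ^+ 2 <= 2^-1.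
Proof.
move=> w0; have w1 : 0 < 1 + w by rewrite addr_gt0.
rewrite sqr_sqrtr; last by rewrite divr_ge0 ?sqrtr_ge0 ?ltW.
rewrite ler_pdivrMr//.
have s0 := sqrtr_ge0 w; have := sqr_sqrtr (ltW w0).
move: s0; set s := Num.sqrt w => s0 sw; rewrite -sw.
have := sqr_ge0 (s - 1); nra.
Qed.

(** The right-hand side is the integrand of [beta_int (m / 4)]. *)
Lemma xw_expr w (m : nat) : 0 < w ->
  w^-1 * xw w ^+ m = w `^ (m%:R / 4 - 1) * (1 + w) `^ (- (2 * (m%:R / 4))).
Proof.
move=> w0; have w1 : 0 < 1 + w by rewrite addr_gt0.
have s0 : 0 <= Num.sqrt w / (1 + w) by rewrite divr_ge0 ?sqrtr_ge0 ?ltW.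
rewrite -powR_mulrn ?xw_ge0// /xw -powR12_sqrt// -powR12_sqrt ?(ltW w0)//.
rewrite -powRrM -[(1 + w)^-1]powR_inv1 ?(ltW w1)// powRM ?powR_ge0//.
rewrite -!powRrM [LHS]mulrA -[w^-1]powR_inv1 ?(ltW w0)//.
rewrite -powRD; last by rewrite (gt_eqF w0) implybT.
by congr (_ `^ _ * _ `^ _); field.
Qed.

Let b (n : nat) : R := Beta ((2 * n + 1)%:R / 4) ((2 * n + 1)%:R / 4).

Let phi (n : nat) (w : R) : R := w^-1 * xw w ^+ (2 * n + 1).

Lemma measurable_xw : measurable_fun [set: R] xw.
Proof.
apply: (measurableT_comp (@measurable_sqrtr R)); apply: measurable_funM.
  exact: measurable_sqrtr.
apply: (measurableT_comp (@measurable_invr R)).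
exact: measurable_funD.
Qed.

Lemma measurable_atan_rem N : measurable_fun [set: R] (@atan_rem R N).
Proof.
apply: continuous_measurable_fun => z; apply: differentiable_continuous.
by apply/derivable1_diffP; apply: ex_derive; exact: is_derive_atan_rem.
Qed.

Let phi_ge0 n w : 0 < w -> 0 <= phi n w.
Proof. by move=> w0; rewrite mulr_ge0 ?exprn_ge0 ?xw_ge0// invr_ge0 ltW. Qed.

Let mphi n : measurable_fun [set: R] (phi n).
Proof.
apply: measurable_funM; first exact: measurable_invr.
by apply: measurable_funX; exact: measurable_xw.
Qed.

Let int_phi n : (\int[mu]_(w in P) (phi n w)%:E = (b n)%:E)%E.
Proof.
rewrite /b -beta_intE; last by rewrite divr_gt0// ltr0n addn1.
apply: eq_integral => w; rewrite inE/= in_itv/= andbT => w0.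
by rewrite /phi xw_expr.
Qed.

Let iphi n : mu.-integrable P (EFin \o phi n).
Proof.
have mE : measurable_fun setT (EFin \o phi n).
  by apply/measurable_EFinP; exact: mphi.
apply/integrableP; split; first exact: measurable_funTS mE.
rewrite (_ : (\int[mu]_(x in P) _ = (b n)%:E)%E) ?ltry// -int_phi.
apply: eq_integral => w; rewrite inE/= in_itv/= andbT => w0.
by rewrite ger0_norm// phi_ge0.
Qed.

Let rem N (w : R) : R := w^-1 * atan_rem N (xw w).

Let mrem N : measurable_fun [set: R] (rem N).
Proof.
apply: measurable_funM; first exact: measurable_invr.
exact: (measurableT_comp (@measurable_atan_rem N) measurable_xw).
Qed.

(** Of the 2 N + 1 factors X(w), one is kept for integrability against dw / w, and the others give
    (X(w)^2)^N <= 2^-N. *)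
Let rem_le N w : 0 < w -> `|rem N w| <= 2^-1 ^+ N * phi 0 w.
Proof.
move=> w0; rewrite /rem /phi muln0 add0n expr1 normrM gtr0_norm ?invr_gt0//.
rewrite mulrCA ler_pM2l ?invr_gt0//.
apply: (le_trans (atan_rem_le N (xw_ge0 w))).
rewrite exprD expr1 ler_wpM2r ?xw_ge0// exprM.
by rewrite lerXn2r ?nnegrE ?sqr_ge0// xw_sqr_le.
Qed.

Let irem N : mu.-integrable P (EFin \o rem N).
Proof.
have mP : measurable (P : set (measurableTypeR R)) by exact: measurable_itv.
apply: (@le_integrable _ _ _ mu P _ _ (fun w => ((2^-1 ^+ N)%:E * (phi 0 w)%:E)%E)) => //.
- by apply: measurable_funTS; apply/measurable_EFinP; exact: mrem.
- move=> w; rewrite /= in_itv/= andbT => w0; rewrite lee_fin.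
  by rewrite [leRHS]ger0_norm ?rem_le// mulr_ge0 ?exprn_ge0 ?phi_ge0.
- exact: (integrableZl mP (2^-1 ^+ N) (iphi 0)).
Qed.

Let A : R := (\int[mu]_(w in P) (w^-1 * atan (xw w)))%R.

Let remE N : (\int[mu]_(w in P) rem N w)%R =
  A - \sum_(n < N) (-1) ^+ n / (2 * n + 1)%:R * b n.
Proof.
have mP : measurable (P : set (measurableTypeR R)) by exact: measurable_itv.
elim: N => [|N IH].
  rewrite big_ord0 subr0; apply: eq_Rintegral => w _.
  by rewrite /rem /atan_rem big_ord0 subr0.
rewrite big_ord_recr/= opprD addrA -IH.
pose c : R := (-1) ^+ N / (2 * N + 1)%:R.
have -> : b N = (\int[mu]_(w in P) phi N w)%R by rewrite /Rintegral int_phi.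
rewrite -(@RintegralZl _ _ _ mu P (phi N) c mP (iphi N)) -(RintegralB mP (irem N) (integrableZl mP c (iphi N))).
apply: eq_Rintegral => w _.
by rewrite /rem /phi /atan_rem big_ord_recr/= -/c; ring.
Qed.

Lemma integral_atan_xw_fin : (\int[mu]_(w in P) (w^-1 * atan (xw w))%:E = A%:E)%E.
Proof.
have mP : measurable (P : set (measurableTypeR R)) by exact: measurable_itv.
rewrite /A /Rintegral fineK//.
(* The remainder of order 0 is the arctangent itself. *)
have := integrable_fin_num mP (irem 0).
congr (_ \is a fin_num); apply: eq_integral => w _.
by rewrite /= /rem /atan_rem big_ord0 subr0.
Qed.

(** The error after N terms is the integral of [rem N], hence at most 2^-N times the first beta
    value. *)
Lemma integral_atan_xw_series :
  (\sum_(n < N) (-1) ^+ n / (2 * n + 1)%:R * b n) @[N --> \oo] --> A.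
Proof.
have mP : measurable (P : set (measurableTypeR R)) by exact: measurable_itv.
have bd N : `|A - \sum_(n < N) (-1) ^+ n / (2 * n + 1)%:R * b n| <= 2^-1 ^+ N * b 0.
  rewrite -remE; apply: (le_trans (le_normr_Rintegral mP (irem N))).
  have -> : b 0 = (\int[mu]_(w in P) phi 0 w)%R by rewrite /Rintegral int_phi.
  rewrite -(@RintegralZl _ _ _ mu P (phi 0) (2^-1 ^+ N) mP (iphi 0)); apply: le_Rintegral => //.
  - exact: (integrable_norm (irem N)).
  - exact: (integrableZl mP (2^-1 ^+ N) (iphi 0)).
  - by move=> w; rewrite /= in_itv/= andbT; exact: rem_le.
apply/cvgrPdist_le => e e0.
have : 2^-1 ^+ N * b 0 @[N --> \oo] --> (0 : R).
  rewrite -(mul0r (b 0)); apply: cvgM; last exact: cvg_cst.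
  by apply: cvg_expr; rewrite ger0_norm; lra.
move=> /cvgrPdist_le/(_ _ e0); apply: filterS => N.
rewrite sub0r normrN => h; apply: le_trans (bd N) _.
by apply: le_trans h; exact: ler_norm.
Qed.

End beta_series.

(** * Identification with the hypergeometric series *)

Lemma pochhammerS (R : realType) (a : R) n :
  pochhammer a n.+1 = pochhammer a n * (a + n%:R).
Proof. by rewrite /pochhammer big_ord_recr. Qed.

(** The summand of 3F2(a, a, 1; a + 1/2, a + 1; 1/4), which covers both series of the theorem, for a
    = 1/4 and a = 3/4. *)
Definition beta_hyp_term (R : realType) (a : R) (m : nat) : R :=
  pochhammer a m * pochhammer a m * pochhammer 1 m
    / (pochhammer (a + 2^-1) m * pochhammer (a + 1) m) * (4^-1 ^+ m / m`!%:R).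

Lemma beta_hyp_term0 (R : realType) (a : R) : beta_hyp_term a 0 = 1.
Proof. by rewrite /beta_hyp_term /pochhammer !big_ord0 fact0; field. Qed.

Lemma beta_hyp_termS (R : realType) (a : R) m : 0 < a ->
  beta_hyp_term a m.+1 = beta_hyp_term a m * ((a + m%:R) ^+ 2 / (4 * (a + 2^-1 + m%:R) * (a + 1 + m%:R))).
Proof.
move=> a0; rewrite /beta_hyp_term !pochhammerS factS natrM exprS.
have m0 : 0 <= m%:R :> R by [].
have n1 : m.+1%:R != 0 :> R by rewrite pnatr_eq0.
have f0 : m`!%:R != 0 :> R by rewrite pnatr_eq0 -lt0n fact_gt0.
have p0 (b : R) : 0 < b -> pochhammer b m != 0.
  by move=> b0; apply/prodf_neq0 => i _; rewrite gt_eqF// ltr_pwDl.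
have ah : 0 < a + 2^-1 by lra.
have h1 := p0 (a + 2^-1) ah.
have h2 := p0 (a + 1) (addr_gt0 a0 ltr01).
have -> : 1 + m%:R = m.+1%:R :> R by rewrite -natr1 addrC.
by field; rewrite f0 h1 h2 /=; apply/and3P; split; rewrite gt_eqF//; lra.
Qed.

(** The ratio of consecutive terms lies in [0, 1/4], because (a + m)^2 <= (a + 1/2 + m) (a + 1 +
    m). *)
Lemma beta_hyp_term_bound (R : realType) (a : R) m : 0 < a ->
  0 <= beta_hyp_term a m <= 4^-1 ^+ m.
Proof.
move=> a0; elim: m => [|m /andP[IH1 IH2]]; first by rewrite beta_hyp_term0 expr0 ler01 lexx.
have m0 : 0 <= m%:R :> R by [].
have d0 : 0 < 4 * (a + 2^-1 + m%:R) * (a + 1 + m%:R).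
  by rewrite !mulr_gt0//; lra.
rewrite beta_hyp_termS//; apply/andP; split.
  by rewrite mulr_ge0// divr_ge0 ?sqr_ge0// ltW.
rewrite [4^-1 ^+ _]exprSr; apply: ler_pM => //.
  by rewrite divr_ge0 ?sqr_ge0 ?(ltW d0).
by rewrite ler_pdivrMr//; have := sqr_ge0 (a + m%:R); nra.
Qed.

Lemma is_cvg_beta_hyp_term (R : realType) (a : R) : 0 < a ->
  cvgn (series (beta_hyp_term a)).
Proof.
move=> a0; apply: (@series_le_cvg _ _ (geometric 1 4^-1)).
- by move=> m; have /andP[] := beta_hyp_term_bound m a0.
- by move=> m; rewrite /geometric/= mul1r exprn_ge0.
- by move=> m; rewrite /geometric/= mul1r; have /andP[] := beta_hyp_term_bound m a0.
- by apply: is_cvg_geometric_series; rewrite ger0_norm; lra.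
Qed.

(** Both sides agree at m = 0 and have the same ratio. With s = m + a, [BetaS] contributes s / (2 (2
    s + 1)) and the denominators s / (s + 1), with product s^2 / (4 (s + 1/2) (s + 1)). *)
Lemma Beta_hyp_term (R : realType) (a : R) m : 0 < a ->
  Beta (m%:R + a) (m%:R + a) / (4 * (m%:R + a))
  = Beta a a / (4 * a) * beta_hyp_term a m.
Proof.
move=> a0; elim: m => [|m IH]; first by rewrite beta_hyp_term0 mulr1 add0r.
have m0 : 0 <= m%:R :> R by [].
have ma : 0 < m%:R + a by rewrite ltr_wpDl.
rewrite beta_hyp_termS// mulrA -IH -natr1 addrAC BetaS//.
set B := Beta _ _.
have h1 : 2 * (m%:R + a) + 1 != 0 :> R by rewrite gt_eqF//; lra.
have h2 : m%:R + a != 0 :> R by rewrite gt_eqF.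
have h3 : m%:R + a + 1 != 0 :> R by rewrite gt_eqF//; lra.
have e4 : a + 2^-1 + m%:R = (2 * (m%:R + a) + 1) / 2 by field.
have e5 : a + 1 + m%:R = m%:R + a + 1 by ring.
have e0 : a + m%:R = m%:R + a by ring.
rewrite e4 e5 e0; clear e4 e5 e0 IH.
move: h1 h2 h3; set q := m%:R + a => h1 h2 h3.
by field; rewrite h1 h2 h3.
Qed.

(** For n = 2 m one has 2 n + 1 = 4 (m + 1/4) and sign +, for n = 2 m + 1 one has 2 n + 1 = 4 (m +
    3/4) and sign -. The factor 1 / (4 a) of [Beta_hyp_term] is then 1, respectively 1/3. *)
Lemma beta_series_even_odd (R : realType) (M : nat) :
  \sum_(n < (2 * M)%N) (-1) ^+ n / (2 * n + 1)%:R
     * Beta ((2 * n + 1)%:R / 4) ((2 * n + 1)%:R / 4)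
  = Beta (1 / 4) (1 / 4) * series (beta_hyp_term (1 / 4)) M
    - 3^-1 * Beta (3 / 4) (3 / 4) * series (beta_hyp_term (3 / 4)) M :> R.
Proof.
have q1 : 0 < 1 / 4 :> R by lra.
have q3 : 0 < 3 / 4 :> R by lra.
have e1 : 4 * (1 / 4) = 1 :> R by lra.
have e3 : 4 * (3 / 4) = 3 :> R by lra.
elim: M => [|M IH].
  by rewrite muln0 big_ord0 /series/= !big_geq// !mulr0 subrr.
rewrite (_ : (2 * M.+1 = (2 * M).+2)%N); last by rewrite mulnS.
rewrite !big_ord_recr/= IH /series/= !big_nat_recr//= !mulrDr.
have M0 : 0 <= M%:R :> R by [].
have := Beta_hyp_term M q1; have := Beta_hyp_term M q3.
rewrite exprS exprM sqrrN expr1n expr1n.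
have n1 : (2 * (2 * M) + 1)%:R = 4 * (M%:R + 1 / 4) :> R.
  by rewrite mulnA natrD natrM; field.
have n3 : (2 * (2 * M).+1 + 1)%:R = 4 * (M%:R + 3 / 4) :> R.
  rewrite (_ : (2 * (2 * M).+1 + 1 = 4 * M + 3)%N); first by rewrite natrD natrM; field.
  by rewrite mulnS mulnA addnAC addnC.
have f4 (x : R) : 4 * x / 4 = x by rewrite mulrC mulKf.
rewrite n1 n3 !f4.
rewrite e1 e3 divr1.
set B1 := Beta (M%:R + 1 / 4) _; set B3 := Beta (M%:R + 3 / 4) _.
move=> h3 h1; rewrite -[Beta (1 / 4) _ * beta_hyp_term _ _]h1.
rewrite [3^-1 * _]mulrC -[_ * beta_hyp_term (3 / 4) _]h3; ring.
Qed.

Lemma hyp3F2_beta_hyp_term (R : realType) (a b1 b2 : R) :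
  b1 = a + 2^-1 -> b2 = a + 1 ->
  hyp3F2 a a 1 b1 b2 (1 / 4) = limn (series (beta_hyp_term a)).
Proof.
move=> -> ->; rewrite /hyp3F2; congr (limn (series _)).
by apply/funext => n; rewrite /beta_hyp_term div1r.
Qed.

Lemma integral_atan_xw (R : realType) :
  (\int[@lebesgue_measure R]_(w in `]0, +oo[) (w^-1 * atan (xw w)))%R
  = Beta (1 / 4) (1 / 4) * hyp3F2 (1 / 4) (1 / 4) 1 (3 / 4) (5 / 4) (1 / 4)
    - 3^-1 * Beta (3 / 4) (3 / 4)
        * hyp3F2 (3 / 4) (3 / 4) 1 (5 / 4) (7 / 4) (1 / 4).
Proof.
rewrite (hyp3F2_beta_hyp_term (a := 1 / 4)); [|lra|lra].
rewrite (hyp3F2_beta_hyp_term (a := 3 / 4)); [|lra|lra].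
have q1 : 0 < 1 / 4 :> R by lra.
have q3 : 0 < 3 / 4 :> R by lra.
have c1 := is_cvg_beta_hyp_term q1; have c3 := is_cvg_beta_hyp_term q3.
(* Only partial sums of even length split into equally long halves, so the limit is taken along the
   subsequence 2 M. *)
have H2 : (2 * M)%N @[M --> \oo] --> \oo.
  by apply/cvgnyPge => k; exists k => // m /= km; rewrite (leq_trans km)// leq_pmull.
have := cvg_comp _ _ H2 (@integral_atan_xw_series R).
rewrite /comp; under eq_fun do rewrite beta_series_even_odd.
move=> /(cvg_lim (@Rhausdorff R)) <-; apply/cvg_lim; first exact: Rhausdorff.
by apply: cvgB; apply: cvgM => //; exact: cvg_cst.
Qed.

Unset Implicit Arguments.

Theorem theorem11 (R : realType) :
  mahler_measure
    (('X + 1) ^+ 2 * ('Y ^+ 2 + 'Y + 1) - 4%:R * 'X * 'Y : {poly {poly R[i]}})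
  = ((pi^-1 : R) *
      (2^-1 * Beta (1 / 4) (1 / 4)
           * hyp3F2 (1 / 4) (1 / 4) 1 (3 / 4) (5 / 4) (1 / 4)
       - 6^-1 * Beta (3 / 4) (3 / 4)
           * hyp3F2 (3 / 4) (3 / 4) 1 (5 / 4) (7 / 4) (1 / 4)))%:E.
Proof.
have fin := @integral_atan_xw_fin R.
rewrite mahler_measure_theorem11_atan; last by rewrite fin ltry.
rewrite fin -EFinM integral_atan_xw; congr EFin.
have p0 := pi_gt0 R; move: (pi : R) p0 => p p0.
by field; rewrite gt_eqF.
Qed.
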